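(* Let $\Omega_D\subset\mathbb{H}$ be a connected circular domain such that $\Omega_D\cap\mathbb{R}=\emptyset$, and let $f:\Omega_D\to\mathbb{H}$ be a non-constant slice regular function. If $x_0\in V(f)$ is not isolated in $V(f)$, then there exists a real smooth surface $\mathcal{S}\subset\Omega_D$ such that $x_0\in\mathcal{S}\subset V(f)$.
   Context: $\mathbb{H}$ is the real algebra of quaternions and $\mathbb{S}=\{q\in\mathbb{H} : q^2=-1\}$; every $x\in\mathbb{H}$ can be written $x=\alpha+J\beta$ with $\alpha,\beta\in\mathbb{R}$, $J\in\mathbb{S}$. $D\subset\mathbb{C}$ is an open set symmetric with respect to the real axis, and the corresponding circular set is $\Omega_D:=\{\alpha+J\beta : \alpha+i\beta\in D,\ J\in\mathbb{S}\}$. Let $\mathbb{H}_{\mathbb{C}}=\mathbb{H}\otimes_{\mathbb{R}}\mathbb{C}=\{p+\sqrt{-1}q : p,q\in\mathbb{H}\}$. A stem function on $D$ is a map $F=F_1+\sqrt{-1}F_2:D\to\mathbb{H}_{\mathbb{C}}$ ($F_1,F_2$ being $\mathbb{H}$-valued) with $F_1(\bar z)=F_1(z)$, $F_2(\bar z)=-F_2(z)$; it induces the slice function $f=\mathcal{I}(F):\Omega_D\to\mathbb{H}$, $f(\alpha+J\beta):=F_1(\alpha+i\beta)+JF_2(\alpha+i\beta)$. The slice function $f=\mathcal{I}(F)$ is slice regular if $F$ is $\mathcal{C}^1$ and $\frac{\partial F}{\partial\bar z}=\frac12\left(\frac{\partial F}{\partial\alpha}+\sqrt{-1}\frac{\partial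 F}{\partial\beta}\right)\equiv 0$ on $D$. $V(f)=\{x\in\Omega_D : f(x)=0\}$ denotes the zero set of $f$. A real smooth surface is a smooth submanifold of real dimension two of $\Omega_D\subset\mathbb{R}^4$. *)

(* Defs.v *)
(* Stdlib world: real numbers with Coquelicot. *)
From Stdlib Require Import Reals.
From Coquelicot Require Import Coquelicot.

Open Scope R_scope.

(** * Quaternions *)

(** [(a, b, c, d)] is a + b i + c j + d k.  As an iterated product of copies of
    [R] it carries the Euclidean norm and topology of R^4. *)
Definition Quat : Type := (R * R * R * R)%type.

Canonical Quat_UniformSpace := UniformSpace.Pack Quat
  (UniformSpace.class
     (prod_UniformSpace
        (prod_UniformSpace
           (prod_UniformSpace R_UniformSpace R_UniformSpace)
           R_UniformSpace)
        R_UniformSpace)) Quat.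

Canonical Quat_NormedModule := NormedModule.Pack R_AbsRing Quat
  (NormedModule.class R_AbsRing
     (prod_NormedModule R_AbsRing
        (prod_NormedModule R_AbsRing
           (prod_NormedModule R_AbsRing R_NormedModule R_NormedModule)
           R_NormedModule)
        R_NormedModule)) Quat.

Definition qreal (a : R) : Quat := (a, 0, 0, 0).

Definition qadd (p q : Quat) : Quat := plus p q.

Definition qopp (p : Quat) : Quat := opp p.

Definition qmul (p q : Quat) : Quat :=
  let '(a1, b1, c1, d1) := p in
  let '(a2, b2, c2, d2) := q in
  (a1 * a2 - b1 * b2 - c1 * c2 - d1 * d2,
   a1 * b2 + b1 * a2 + c1 * d2 - d1 * c2,
   a1 * c2 - b1 * d2 + c1 * a2 + d1 * b2,
   a1 * d2 + b1 * c2 - c1 * b2 + d1 * a2).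

Definition imag_unit (J : Quat) : Prop := qmul J J = qreal (- 1).

(** alpha + J beta *)
Definition slice_point (J : Quat) (alpha beta : R) : Quat :=
  qadd (qreal alpha) (qmul J (qreal beta)).

(** * Topology and differentiability *)

Definition connected {T : UniformSpace} (A : T -> Prop) : Prop :=
  forall U V : T -> Prop,
    open U -> open V ->
    (forall x, A x -> U x \/ V x) ->
    (exists x, A x /\ U x) ->
    (exists x, A x /\ V x) ->
    exists x, A x /\ U x /\ V x.

Definition isolated {T : UniformSpace} (A : T -> Prop) (x : T) : Prop :=
  A x /\ locally x (fun y => A y -> y = x).

Definition is_partial1 {V : NormedModule R_AbsRing}
    (g : R * R -> V) (p : R * R) (l : V) : Prop :=
  is_derive (fun t : R => g (t, snd p)) (fst p) l.

Definition is_partial2 {V : NormedModule R_AbsRing}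
    (g : R * R -> V) (p : R * R) (l : V) : Prop :=
  is_derive (fun t : R => g (fst p, t)) (snd p) l.

(** Class C^k on an open set [U] of the plane: all iterated partial derivatives
    of order at most [k] exist on [U], and those of order exactly [k] are
    continuous there (hence so are those of lower order). *)
Fixpoint class_C {V : NormedModule R_AbsRing} (k : nat)
    (U : R * R -> Prop) (g : R * R -> V) : Prop :=
  match k with
  | O => forall p, U p -> continuous g p
  | S k' =>
      exists g1 g2 : R * R -> V,
        (forall p, U p -> is_partial1 g p (g1 p) /\ is_partial2 g p (g2 p)) /\
        class_C k' U g1 /\ class_C k' U g2
  end.

Definition smooth {V : NormedModule R_AbsRing}
    (U : R * R -> Prop) (g : R * R -> V) : Prop :=
  forall k, class_C k U g.

(** The differential of [g] is injective at every point of [U]. *)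
Definition immersive {V : NormedModule R_AbsRing}
    (U : R * R -> Prop) (g : R * R -> V) : Prop :=
  forall p l1 l2, U p -> is_partial1 g p l1 -> is_partial2 g p l2 ->
    forall a b : R, plus (scal a l1) (scal b l2) = zero -> a = 0 /\ b = 0.

(** Smooth two-dimensional (embedded) submanifold of R^4: near each of its points
    [M] is the image of a smooth immersion [phi] of an open set [W] of the plane
    which is a homeomorphism from [W] onto the relatively open piece of [M]
    lying in [U]; [psi] is the inverse homeomorphism. *)
Definition smooth_surface (M : Quat -> Prop) : Prop :=
  forall x, M x ->
    exists (U : Quat -> Prop) (W : R * R -> Prop)
           (phi : R * R -> Quat) (psi : Quat -> R * R),
      open U /\ U x /\ open W /\
      smooth W phi /\ immersive W phi /\
      (forall w, W w -> M (phi w) /\ U (phi w) /\ psi (phi w) = w) /\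
      (forall y, M y -> U y -> W (psi y) /\ phi (psi y) = y) /\
      continuous_on (fun y => M y /\ U y) psi.

(** * Slice regular functions *)

Definition conj_symmetric (D : C -> Prop) : Prop :=
  forall z, D z -> D (Cconj z).

Definition circular_set (D : C -> Prop) (x : Quat) : Prop :=
  exists (alpha beta : R) (J : Quat),
    D (alpha, beta) /\ imag_unit J /\ x = slice_point J alpha beta.

(** The complexified algebra: [(p, q)] is p + sqrt(-1) q. *)
Definition HC : Type := (Quat * Quat)%type.

Canonical HC_UniformSpace := UniformSpace.Pack HC
  (UniformSpace.class
     (prod_UniformSpace Quat_UniformSpace Quat_UniformSpace)) HC.

Canonical HC_NormedModule := NormedModule.Pack R_AbsRing HC
  (NormedModule.class R_AbsRing
     (prod_NormedModule R_AbsRing Quat_NormedModule Quat_NormedModule)) HC.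

(** Multiplication by sqrt(-1), which commutes with the quaternions. *)
Definition HC_mul_i (w : HC) : HC := (qopp (snd w), fst w).

Definition stem (D : C -> Prop) (F : C -> HC) : Prop :=
  forall z, D z ->
    fst (F (Cconj z)) = fst (F z) /\ snd (F (Cconj z)) = qopp (snd (F z)).

(** [f] agrees on [circular_set D] with the slice function induced by [F];
    values of [f] outside that set are irrelevant. *)
Definition induced_by (D : C -> Prop) (F : C -> HC) (f : Quat -> Quat) : Prop :=
  forall (alpha beta : R) (J : Quat),
    D (alpha, beta) -> imag_unit J ->
    f (slice_point J alpha beta) =
      qadd (fst (F (alpha, beta))) (qmul J (snd (F (alpha, beta)))).

(** [l] is the value at [z] of the derivative of [F] with respect to the
    conjugate variable. *)
Definition is_dbar (F : C -> HC) (z : C) (l : HC) : Prop :=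
  exists Fa Fb : HC,
    is_partial1 F z Fa /\ is_partial2 F z Fb /\
    l = scal (1 / 2) (plus Fa (HC_mul_i Fb)).

Definition slice_regular (D : C -> Prop) (f : Quat -> Quat) : Prop :=
  exists F : C -> HC,
    stem D F /\ induced_by D F f /\ class_C 1 D F /\
    forall z, D z -> is_dbar F z zero.

Definition constant_on (A : Quat -> Prop) (f : Quat -> Quat) : Prop :=
  exists c, forall x, A x -> f x = c.

Definition zero_set (D : C -> Prop) (f : Quat -> Quat) (x : Quat) : Prop :=
  circular_set D x /\ f x = zero.

(* Main.v *)
Require Import Defs.
From Stdlib Require Import Reals Lra Lia Wf_nat Classical.
From Coquelicot Require Import Coquelicot.

(** With [F = F1 + sqrt(-1) F2] the stem function, the four numbers [F1_i + sqrt(-1) F2_i]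
    formed from the real coordinates are holomorphic functions of [z], and so is the sum [N] of
    their squares.  On the sphere over [z] the function [f] vanishes everywhere if [F z = 0];
    otherwise it has at most one zero, at [J = - F1 F2^{-1}], and it has one exactly when
    [N z = 0].  If [F z0 = 0] at the point [z0] under [x0], the surface is the sphere over [z0].
    If not, [z0] cannot be an isolated zero of [N], hence [N] vanishes near [z0] and the
    surface is the graph [z |-> alpha + J(z) beta].  Smoothness of [F] and the isolation of the
    zeros of [N] both come from Cauchy's formula, obtained by shrinking the circle to a point. *)

(** Near a point where [F] does not vanish, a zero determines its unit [J]. Zeros can therefore
    accumulate only through changing [z], and a question about [R^4] becomes one about the single
    holomorphic function [N]. As there are no real points in the domain, each of its points is
    [alpha + J beta] for exactly one [z] with [beta > 0]. This [z] depends continuously on the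
    point, which both transports neighbourhoods down to [D] and inverts the chart of the graph.
    Smoothness asks for iterated partial derivatives of all orders of a quotient. No formula for
    them is written: the coordinates of the surface lie in a family of functions that contains
    Cauchy integrals and is closed under sums, products, inverses and partial derivatives. The
    circle can be shrunk because the derivative of the integrand in the contraction parameter is
    also the derivative, in the angle, of a periodic function. *)

(** * Calculus of pairs and of complex-valued functions *)

Lemma is_derive_pair {U V : NormedModule R_AbsRing} (f : R -> U) (g : R -> V)
    (x : R) (lf : U) (lg : V) :
  is_derive f x lf -> is_derive g x lg ->
  is_derive (V := prod_NormedModule R_AbsRing U V) (fun t => (f t, g t)) x (lf, lg).
Proof.
  intros Hf Hg.
  refine (filterdiff_ext_lin _ _ _
    (filterdiff_comp'_2 f g (fun u v => (u, v) : prod_NormedModule R_AbsRing U V)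
       x _ _ (fun u v => (u, v)) Hf Hg _) _).
  - apply filterdiff_ext with (f := fun t : prod_NormedModule R_AbsRing U V => t).
    { now intros [u v]. }
    apply filterdiff_ext_lin with (l1 := fun t : prod_NormedModule R_AbsRing U V => t).
    { apply filterdiff_id. }
    now intros [u v].
  - reflexivity.
Qed.

Lemma is_derive_fst {U V : NormedModule R_AbsRing} (f : R -> U * V) (x : R) (l : U * V) :
  is_derive (V := prod_NormedModule R_AbsRing U V) f x l ->
  is_derive (fun t => fst (f t)) x (fst l).
Proof.
  intros Hf.
  refine (filterdiff_ext_lin _ _ _
    (filterdiff_comp' (V := prod_NormedModule R_AbsRing U V) f fst x _ _ Hf _) _).
  - apply filterdiff_linear, is_linear_fst.
  - reflexivity.
Qed.

Lemma is_derive_snd {U V : NormedModule R_AbsRing} (f : R -> U * V) (x : R) (l : U * V) :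
  is_derive (V := prod_NormedModule R_AbsRing U V) f x l ->
  is_derive (fun t => snd (f t)) x (snd l).
Proof.
  intros Hf.
  refine (filterdiff_ext_lin _ _ _
    (filterdiff_comp' (V := prod_NormedModule R_AbsRing U V) f snd x _ _ Hf _) _).
  - apply filterdiff_linear, is_linear_snd.
  - reflexivity.
Qed.

Lemma continuous_pair {T U V : UniformSpace} (f : T -> U) (g : T -> V) (x : T) :
  continuous f x -> continuous g x ->
  continuous (U := prod_UniformSpace U V) (fun t => (f t, g t)) x.
Proof.
  intros Hf Hg.
  apply (continuous_comp_2 f g (fun u v => (u, v) : prod_UniformSpace U V) x Hf Hg).
  apply continuous_ext with (f := fun t : prod_UniformSpace U V => t).
  - now intros [u v].
  - apply continuous_id.
Qed.

Lemma continuous_comp_fst {T U V : UniformSpace} (f : T -> U * V) (x : T) :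
  continuous (U := prod_UniformSpace U V) f x -> continuous (fun t => fst (f t)) x.
Proof.
  intros Hf. apply (continuous_comp f fst x Hf).
  destruct (f x). apply continuous_fst.
Qed.

Lemma continuous_comp_snd {T U V : UniformSpace} (f : T -> U * V) (x : T) :
  continuous (U := prod_UniformSpace U V) f x -> continuous (fun t => snd (f t)) x.
Proof.
  intros Hf. apply (continuous_comp f snd x Hf).
  destruct (f x). apply continuous_snd.
Qed.

(** [C] is also a module over itself; the scalars are fixed to [R] because all derivatives are taken
    along real curves. *)
Notation C_is_derive f x l :=
  (is_derive (K := R_AbsRing) (V := C_R_NormedModule) f x l).

Lemma continuous_Re {T : UniformSpace} (f : T -> C) (x : T) :
  continuous f x -> continuous (fun t => Re (f t)) x.
Proof. exact (continuous_comp_fst f x). Qed.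

Lemma continuous_Im {T : UniformSpace} (f : T -> C) (x : T) :
  continuous f x -> continuous (fun t => Im (f t)) x.
Proof. exact (continuous_comp_snd f x). Qed.

Lemma continuous_Rmult {T : UniformSpace} (f g : T -> R) (x : T) :
  continuous f x -> continuous g x -> continuous (fun t => f t * g t) x.
Proof. exact (continuous_mult f g x). Qed.

Lemma continuous_Rplus {T : UniformSpace} (f g : T -> R) (x : T) :
  continuous f x -> continuous g x -> continuous (fun t => f t + g t) x.
Proof. exact (continuous_plus (V := R_NormedModule) f g x). Qed.

Lemma continuous_Ropp {T : UniformSpace} (f : T -> R) (x : T) :
  continuous f x -> continuous (fun t => - f t) x.
Proof. exact (continuous_opp (V := R_NormedModule) f x). Qed.

Lemma continuous_Rinv' {T : UniformSpace} (f : T -> R) (x : T) :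
  continuous f x -> f x <> 0 -> continuous (fun t => / f t) x.
Proof. intros Hf Hx. apply (continuous_comp f Rinv); [easy|]. now apply continuous_Rinv. Qed.

Lemma continuous_Cmult {T : UniformSpace} (f g : T -> C) (x : T) :
  continuous f x -> continuous g x -> continuous (fun t => Cmult (f t) (g t)) x.
Proof.
  intros Hf Hg.
  pose proof (continuous_Re f x Hf). pose proof (continuous_Im f x Hf).
  pose proof (continuous_Re g x Hg). pose proof (continuous_Im g x Hg).
  apply continuous_pair;
    (apply continuous_Rplus; [|try apply continuous_Ropp]; apply continuous_Rmult; assumption).
Qed.

Lemma continuous_Cplus {T : UniformSpace} (f g : T -> C) (x : T) :
  continuous f x -> continuous g x -> continuous (fun t => Cplus (f t) (g t)) x.
Proof.
  intros Hf Hg. apply continuous_pair.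
  - exact (continuous_Rplus _ _ x (continuous_Re f x Hf) (continuous_Re g x Hg)).
  - exact (continuous_Rplus _ _ x (continuous_Im f x Hf) (continuous_Im g x Hg)).
Qed.

Lemma continuous_Copp {T : UniformSpace} (f : T -> C) (x : T) :
  continuous f x -> continuous (fun t => Copp (f t)) x.
Proof.
  intros Hf. apply continuous_pair.
  - exact (continuous_Ropp _ x (continuous_Re f x Hf)).
  - exact (continuous_Ropp _ x (continuous_Im f x Hf)).
Qed.

Lemma C_normsq_neq_0 (z : C) : z <> 0 -> fst z ^ 2 + snd z ^ 2 <> 0.
Proof.
  intros Hz H. apply Hz. destruct z as [a b]; simpl in *.
  assert (a = 0) by nra. assert (b = 0) by nra. now subst.
Qed.

Lemma continuous_Cinv {T : UniformSpace} (f : T -> C) (x : T) :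
  continuous f x -> f x <> 0 -> continuous (fun t => Cinv (f t)) x.
Proof.
  intros Hf Hx.
  pose proof (continuous_Re f x Hf). pose proof (continuous_Im f x Hf).
  assert (continuous (fun t => / (fst (f t) ^ 2 + snd (f t) ^ 2)) x).
  { apply continuous_Rinv'.
    - apply continuous_ext with
        (f := fun t => Re (f t) * Re (f t) + Im (f t) * Im (f t)).
      { intro t; unfold Re, Im; simpl; ring. }
      apply continuous_Rplus; now apply continuous_Rmult.
    - now apply C_normsq_neq_0. }
  apply continuous_pair; apply continuous_Rmult; try assumption.
  now apply continuous_Ropp.
Qed.

Lemma is_derive_eq {V : NormedModule R_AbsRing} (f : R -> V) (x : R) (l l' : V) :
  is_derive f x l -> l = l' -> is_derive f x l'.
Proof. now intros H <-. Qed.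

Lemma is_derive_Rplus (f g : R -> R) (x df dg : R) :
  is_derive f x df -> is_derive g x dg -> is_derive (fun t => f t + g t) x (df + dg).
Proof. exact (is_derive_plus f g x df dg). Qed.

Lemma is_derive_Ropp (f : R -> R) (x df : R) :
  is_derive f x df -> is_derive (fun t => - f t) x (- df).
Proof. exact (is_derive_opp f x df). Qed.

Lemma C_is_derive_mult (f g : R -> C) (x : R) (df dg : C) :
  C_is_derive f x df -> C_is_derive g x dg ->
  C_is_derive (fun t => Cmult (f t) (g t)) x (Cplus (Cmult df (g x)) (Cmult (f x) dg)).
Proof.
  intros Hf Hg.
  pose proof (is_derive_fst _ _ _ Hf). pose proof (is_derive_snd _ _ _ Hf).
  pose proof (is_derive_fst _ _ _ Hg). pose proof (is_derive_snd _ _ _ Hg).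
  apply (is_derive_eq _ _
    (fst df * fst (g x) + fst (f x) * fst dg - (snd df * snd (g x) + snd (f x) * snd dg),
     fst df * snd (g x) + fst (f x) * snd dg + (snd df * fst (g x) + snd (f x) * fst dg))).
  - apply (is_derive_pair (U := R_NormedModule) (V := R_NormedModule)).
    + apply is_derive_Rplus; [|apply is_derive_Ropp]; now apply Derive.is_derive_mult.
    + apply is_derive_Rplus; now apply Derive.is_derive_mult.
  - unfold Cplus, Cmult; simpl; f_equal; ring.
Qed.

Lemma C_is_derive_plus (f g : R -> C) (x : R) (df dg : C) :
  C_is_derive f x df -> C_is_derive g x dg ->
  C_is_derive (fun t => Cplus (f t) (g t)) x (Cplus df dg).
Proof. exact (is_derive_plus f g x df dg). Qed.

Lemma C_is_derive_opp (f : R -> C) (x : R) (df : C) :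
  C_is_derive f x df -> C_is_derive (fun t => Copp (f t)) x (Copp df).
Proof. exact (is_derive_opp f x df). Qed.

Lemma C_is_derive_const (c : C) (x : R) : C_is_derive (fun _ => c) x (RtoC 0).
Proof. exact (is_derive_const (V := C_R_NormedModule) c (x : R_AbsRing)). Qed.

Lemma C_is_derive_RtoC (x : R) : C_is_derive RtoC x (RtoC 1).
Proof.
  apply (is_derive_pair (U := R_NormedModule) (V := R_NormedModule)).
  - exact (is_derive_id x).
  - exact (is_derive_const 0 x).
Qed.

Lemma C_is_derive_inv (f : R -> C) (x : R) (df : C) :
  C_is_derive f x df -> f x <> 0 ->
  C_is_derive (fun t => Cinv (f t)) x (Copp (Cmult df (Cmult (Cinv (f x)) (Cinv (f x))))).
Proof.
  intros Hf Hx.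
  pose proof (is_derive_fst _ _ _ Hf) as Hr. pose proof (is_derive_snd _ _ _ Hf) as Hi.
  pose proof (C_normsq_neq_0 _ Hx) as Hn.
  assert (Hq : is_derive (fun t => fst (f t) ^ 2 + snd (f t) ^ 2) x
                 (2 * fst df * fst (f x) + 2 * snd df * snd (f x))).
  { eapply is_derive_eq.
    - apply is_derive_Rplus; apply is_derive_pow; eassumption.
    - simpl; ring. }
  eapply is_derive_eq.
  - apply (is_derive_pair (U := R_NormedModule) (V := R_NormedModule)).
    + eapply is_derive_div; eassumption.
    + eapply is_derive_div; [apply is_derive_Ropp|..]; eassumption.
  - unfold Copp, Cinv, Cmult; simpl in *. destruct (f x) as [a b]; destruct df as [c d]; simpl in *.
    f_equal; field; simpl; lra.
Qed.

Lemma R_is_derive_eq (f : R -> R) (x l l' : R) :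
  is_derive f x l -> l = l' -> is_derive f x l'.
Proof. now intros H <-. Qed.

(** Unlike the generic [is_derive_eq], this leaves the equation between derivatives at the type [C],
    ready for [ring]. *)
Lemma C_is_derive_eq (f : R -> C) (x : R) (l l' : C) :
  C_is_derive f x l -> l = l' -> C_is_derive f x l'.
Proof. now intros H <-. Qed.

Lemma C_is_derive_unique (f : R -> C) (x : R) (l l' : C) :
  C_is_derive f x l -> C_is_derive f x l' -> l = l'.
Proof.
  intros H H'.
  pose proof (is_derive_unique _ _ _ (is_derive_fst _ _ _ H)).
  pose proof (is_derive_unique _ _ _ (is_derive_snd _ _ _ H)).
  pose proof (is_derive_unique _ _ _ (is_derive_fst _ _ _ H')).
  pose proof (is_derive_unique _ _ _ (is_derive_snd _ _ _ H')).
  destruct l, l'; simpl in *; congruence.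
Qed.

(** Balls of the product structure on [C] are squares; the square of half side [eps / sqrt 2] lies
    in the disc of radius [eps]. *)
Lemma locally_Cmod (z : C) (P : C -> Prop) :
  locally z P <-> exists eps, 0 < eps /\ forall w, Cmod (w - z) < eps -> P w.
Proof.
  split.
  - intros [eps H]. exists eps; split; [apply cond_pos|].
    intros w Hw. apply H. exact (C_NormedModule_mixin_compat1 z w eps Hw).
  - intros [eps [He H]].
    assert (H2 : 0 < sqrt 2) by (apply sqrt_lt_R0; lra).
    assert (He' : 0 < eps / sqrt 2) by now apply Rdiv_lt_0_compat.
    exists (mkposreal _ He'). intros w Hw. apply H.
    replace eps with (sqrt 2 * (eps / sqrt 2)) by (field; lra).
    exact (C_NormedModule_mixin_compat2 z w (mkposreal _ He') Hw).
Qed.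

(** * Cauchy's formula *)

(** The Cauchy-Riemann equations with a continuous derivative: what a stem function of class C^1
    with vanishing [is_dbar] supplies in each coordinate. *)
Definition holomorphic_on (D : C -> Prop) (g g' : C -> C) : Prop :=
  forall z, D z ->
    C_is_derive (fun t : R => g (t, snd z)) (fst z) (g' z) /\
    C_is_derive (fun t : R => g (fst z, t)) (snd z) (Cmult Ci (g' z)) /\
    continuous g' z.

Lemma open_ball_Cmod (D : C -> Prop) (z : C) :
  open D -> D z -> exists eps, 0 < eps /\ forall w, Cmod (w - z) < eps -> D w.
Proof. intros HD Hz. apply locally_Cmod. now apply HD. Qed.

(** One partial derivative existing nearby and continuous at [z], together with the other at [z],
    gives total differentiability, from which the chain rule along curves follows. *)
Lemma holomorphic_filterdiff (D : C -> Prop) (g g' : C -> C) (z : C) :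
  open D -> holomorphic_on D g g' -> D z ->
  filterdiff (V := C_R_NormedModule) g (locally z) (fun d => Cmult d (g' z)).
Proof.
  intros HD Hg Hz. destruct z as [x y].
  destruct (Hg (x, y) Hz) as (_ & H2 & H3); simpl in H2.
  assert (Hloc : locally ((x, y) : R * R) (fun u : R * R => D u)) by now apply HD.
  assert (Hu : filterdiff (fun u : R * R => fst (g (fst u, snd u))) (locally (x, y))
     (fun u => plus (scal (fst u) (fst (g' (x, y))))
                    (scal (snd u) (fst (Cmult Ci (g' (x, y))))))).
  { apply (is_derive_filterdiff (fun a b => fst (g (a, b))) x y
       (fun a b => fst (g' (a, b)))).
    - revert Hloc; apply filter_imp. intros [a b] Hab.
      exact (is_derive_fst _ _ _ (proj1 (Hg (a, b) Hab))).
    - exact (is_derive_fst _ _ _ H2).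
    - apply continuous_ext with (f := fun u => fst (g' u)); [now intros [a b]|].
      now apply continuous_comp_fst. }
  assert (Hv : filterdiff (fun u : R * R => snd (g (fst u, snd u))) (locally (x, y))
     (fun u => plus (scal (fst u) (snd (g' (x, y))))
                    (scal (snd u) (snd (Cmult Ci (g' (x, y))))))).
  { apply (is_derive_filterdiff (fun a b => snd (g (a, b))) x y
       (fun a b => snd (g' (a, b)))).
    - revert Hloc; apply filter_imp. intros [a b] Hab.
      exact (is_derive_snd _ _ _ (proj1 (Hg (a, b) Hab))).
    - exact (is_derive_snd _ _ _ H2).
    - apply continuous_ext with (f := fun u => snd (g' u)); [now intros [a b]|].
      now apply continuous_comp_snd. }
  eapply filterdiff_ext_lin.
  - apply filterdiff_ext with (f := fun u : R * R =>
      (fst (g (fst u, snd u)), snd (g (fst u, snd u))) : C).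
    { intros [a b]; symmetry; exact (surjective_pairing (g (a, b))). }
    eapply (filterdiff_comp'_2 (W := C_R_NormedModule) _ _ (fun u v => (u, v) : C)
       _ _ _ (fun u v => (u, v) : C) Hu Hv).
    apply filterdiff_ext with (f := fun t : C_R_NormedModule => t).
    { now intros [u v]. }
    apply filterdiff_ext_lin with (l1 := fun t : C_R_NormedModule => t).
    { apply filterdiff_id. }
    now intros [u v].
  - intros [a b]. unfold plus, scal, Cmult; simpl; unfold mult; simpl. f_equal; ring.
Qed.

Lemma holomorphic_continuous (D : C -> Prop) (g g' : C -> C) (z : C) :
  open D -> holomorphic_on D g g' -> D z -> continuous g z.
Proof.
  intros HD Hg Hz.
  apply (filterdiff_continuous (V := C_R_NormedModule) g z).
  eexists. now apply (holomorphic_filterdiff D g g').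
Qed.

Lemma holomorphic_comp (D : C -> Prop) (g g' : C -> C) (c : R -> C) (t : R) (c' : C) :
  open D -> holomorphic_on D g g' -> D (c t) -> C_is_derive c t c' ->
  C_is_derive (fun s => g (c s)) t (Cmult c' (g' (c t))).
Proof.
  intros HD Hg Ht Hc.
  refine (filterdiff_ext_lin _ _ _
    (filterdiff_comp' (V := C_R_NormedModule) (W := C_R_NormedModule) c g t _ _ Hc
       (holomorphic_filterdiff D g g' (c t) HD Hg Ht)) _).
  intro y. destruct c' as [a b], (g' (c t)) as [p q].
  unfold scal, Cmult; simpl; unfold prod_scal, scal; simpl; unfold mult; simpl.
  f_equal; ring.
Qed.

Lemma holomorphic_plus (D : C -> Prop) (g g' h h' : C -> C) :
  holomorphic_on D g g' -> holomorphic_on D h h' ->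
  holomorphic_on D (fun z => Cplus (g z) (h z)) (fun z => Cplus (g' z) (h' z)).
Proof.
  intros Hg Hh [x y] Hz.
  destruct (Hg _ Hz) as (G1 & G2 & G3), (Hh _ Hz) as (H1 & H2 & H3). split; [|split].
  - exact (C_is_derive_plus _ _ _ _ _ G1 H1).
  - eapply C_is_derive_eq; [exact (C_is_derive_plus _ _ _ _ _ G2 H2)|]. cbn [fst snd]. ring.
  - now apply continuous_Cplus.
Qed.

Lemma holomorphic_mult (D : C -> Prop) (g g' h h' : C -> C) :
  open D -> holomorphic_on D g g' -> holomorphic_on D h h' ->
  holomorphic_on D (fun z => Cmult (g z) (h z))
    (fun z => Cplus (Cmult (g' z) (h z)) (Cmult (g z) (h' z))).
Proof.
  intros HD Hg Hh z Hz.
  destruct (Hg z Hz) as (G1 & G2 & G3), (Hh z Hz) as (H1 & H2 & H3).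
  pose proof (holomorphic_continuous _ _ _ _ HD Hg Hz).
  pose proof (holomorphic_continuous _ _ _ _ HD Hh Hz).
  destruct z as [x y]. split; [|split].
  - exact (C_is_derive_mult _ _ _ _ _ G1 H1).
  - eapply C_is_derive_eq; [exact (C_is_derive_mult _ _ _ _ _ G2 H2)|]. cbn [fst snd]. ring.
  - apply continuous_Cplus; now apply continuous_Cmult.
Qed.

(** * Integrals of complex-valued functions of a real variable *)

Definition C_RInt (f : R -> C) (a b : R) : C :=
  RInt (V := C_R_CompleteNormedModule) f a b.

Lemma C_RInt_eq (f : R -> C) (a b : R) :
  (forall t, continuous f t) ->
  C_RInt f a b = (RInt (fun t => fst (f t)) a b, RInt (fun t => snd (f t)) a b).
Proof.
  intros Hf. unfold C_RInt. apply (is_RInt_unique (V := C_R_CompleteNormedModule)).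
  apply (is_RInt_fct_extend_pair (U := R_NormedModule) (V := R_NormedModule)).
  - apply (RInt_correct (V := R_CompleteNormedModule)).
    apply (ex_RInt_continuous (V := R_CompleteNormedModule)).
    intros t _. now apply (continuous_comp_fst f).
  - apply (RInt_correct (V := R_CompleteNormedModule)).
    apply (ex_RInt_continuous (V := R_CompleteNormedModule)).
    intros t _. now apply (continuous_comp_snd f).
Qed.

Lemma C_RInt_correct (f : R -> C) (a b : R) :
  (forall t, continuous f t) ->
  is_RInt (V := C_R_NormedModule) f a b (C_RInt f a b).
Proof.
  intros Hf. apply (RInt_correct (V := C_R_CompleteNormedModule)).
  apply (ex_RInt_continuous (V := C_R_CompleteNormedModule)). now intros t _.
Qed.

Lemma C_RInt_FTC (f df : R -> C) (a b : R) :
  (forall t, C_is_derive f t (df t)) -> (forall t, continuous df t) ->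
  C_RInt df a b = Cminus (f b) (f a).
Proof.
  intros Hd Hc. unfold C_RInt. apply (is_RInt_unique (V := C_R_CompleteNormedModule)).
  apply (is_RInt_derive (V := C_R_CompleteNormedModule)); now intros.
Qed.

Lemma C_RInt_plus (f g : R -> C) (a b : R) :
  (forall t, continuous f t) -> (forall t, continuous g t) ->
  C_RInt (fun t => Cplus (f t) (g t)) a b = Cplus (C_RInt f a b) (C_RInt g a b).
Proof.
  intros Hf Hg. unfold C_RInt at 1. apply (is_RInt_unique (V := C_R_CompleteNormedModule)).
  apply (is_RInt_plus (V := C_R_NormedModule) f g); now apply C_RInt_correct.
Qed.

Lemma C_RInt_mult_l (f : R -> C) (c : C) (a b : R) :
  (forall t, continuous f t) ->
  C_RInt (fun t => Cmult c (f t)) a b = Cmult c (C_RInt f a b).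
Proof.
  intros Hf. pose proof (C_RInt_correct f a b Hf) as H.
  unfold C_RInt at 1. apply (is_RInt_unique (V := C_R_CompleteNormedModule)).
  pose proof (is_RInt_fct_extend_fst _ _ _ _ H) as Hr.
  pose proof (is_RInt_fct_extend_snd _ _ _ _ H) as Hi.
  apply (is_RInt_fct_extend_pair (U := R_NormedModule) (V := R_NormedModule)).
  - exact (is_RInt_minus _ _ _ _ _ _
      (is_RInt_scal _ _ _ (fst c) _ Hr) (is_RInt_scal _ _ _ (snd c) _ Hi)).
  - exact (is_RInt_plus _ _ _ _ _ _
      (is_RInt_scal _ _ _ (fst c) _ Hi) (is_RInt_scal _ _ _ (snd c) _ Hr)).
Qed.

Lemma C_RInt_ext (f g : R -> C) (a b : R) :
  (forall t, f t = g t) -> C_RInt f a b = C_RInt g a b.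
Proof. intros H. apply (RInt_ext (V := C_R_CompleteNormedModule)). now intros. Qed.

Lemma C_RInt_bound (f : R -> C) (a b M : R) :
  a <= b -> (forall t, continuous f t) -> (forall t, a <= t <= b -> Cmod (f t) <= M) ->
  Cmod (C_RInt f a b) <= (b - a) * M.
Proof.
  intros Hab Hf HM. rewrite Cmod_norm.
  apply (norm_RInt_le_const (V := C_R_NormedModule) f a b _ M Hab).
  - intros t Ht. change (norm (f t)) with (@norm _ C_R_NormedModule (f t)).
    rewrite <- Cmod_norm. now apply HM.
  - now apply C_RInt_correct.
Qed.

(** Homotopy invariance of a contour integral.  The parameter ranges over a neighbourhood of
    [[0, 1]] so that no one-sided derivatives occur at the end points. *)
Lemma C_RInt_param_constant (f df : R -> R -> C) (b : R) :
  (forall s t, -1 < s < 2 -> C_is_derive (fun u => f u t) s (df s t)) ->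
  (forall s t, -1 < s < 2 -> continuous (fun p : R * R => df (fst p) (snd p)) (s, t)) ->
  (forall s t, -1 < s < 2 -> continuous (f s) t) ->
  (forall s, -1 < s < 2 -> C_RInt (df s) 0 b = 0) ->
  C_RInt (f 0) 0 b = C_RInt (f 1) 0 b.
Proof.
  intros Hd Hdc Hc H0.
  assert (Hopen : forall s, -1 < s < 2 -> locally s (fun s => -1 < s < 2)).
  { intros s Hs. apply (open_and (fun s => -1 < s) (fun s => s < 2)); [apply open_gt|apply open_lt|easy]. }
  assert (Hdct : forall s t, -1 < s < 2 -> continuous (df s) t).
  { intros s t Hs.
    apply (continuous_comp (fun t : R => (s, t) : R * R)
             (fun p : R * R => df (fst p) (snd p)) t).
    - apply continuous_pair; [apply continuous_const|apply continuous_id].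
    - now apply Hdc. }
  (* Differentiation under the integral sign is carried out on real integrands; [pr] is the real or
     the imaginary part. *)
  assert (Hcomp : forall pr : C -> R,
    (forall g t l, C_is_derive g t l -> is_derive (fun u => pr (g u)) t (pr l)) ->
    (forall (T : UniformSpace) (g : T -> C) x, continuous g x -> continuous (fun u => pr (g u)) x) ->
    (forall s, -1 < s < 2 -> RInt (fun t => pr (df s t)) 0 b = 0) ->
    RInt (fun t => pr (f 0 t)) 0 b = RInt (fun t => pr (f 1 t)) 0 b).
  { intros pr Pd Pc P0.
    apply (eq_is_derive (fun s => RInt (fun t => pr (f s t)) 0 b) 0 1); [|lra].
    intros s Hs. assert (Hs' : -1 < s < 2) by lra.
    assert (HD : forall s t, -1 < s < 2 -> Derive (fun u => pr (f u t)) s = pr (df s t)).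
    { intros; apply is_derive_unique, Pd. now apply Hd. }
    eapply is_derive_eq.
    - apply (is_derive_RInt_param (fun s t => pr (f s t))).
      + generalize (Hopen s Hs'); apply filter_imp. intros u Hu t _.
        eexists. apply Pd. now apply Hd.
      + intros t _. apply continuity_2d_pt_filterlim.
        apply (continuous_ext_loc (fun p : R * R => Derive (fun z => pr (f z (snd p))) (fst p))
                 (fun p : R * R => pr (df (fst p) (snd p))) (s, t)).
        * assert (Hl : locally (s, t) (fun p : R * R => -1 < fst p < 2)).
          { exact (continuous_fst s t _ (Hopen s Hs')). }
          revert Hl; apply filter_imp. intros p Hp. symmetry. now apply HD.
        * apply Pc, Hdc. easy.
      + generalize (Hopen s Hs'); apply filter_imp. intros u Hu.
        apply (ex_RInt_continuous (V := R_CompleteNormedModule)).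
        intros t _. apply (Pc _ (f u)). now apply Hc.
    - refine (eq_trans _ (P0 s Hs')).
      apply (RInt_ext (V := R_CompleteNormedModule)). intros t _. now apply HD. }
  rewrite !C_RInt_eq by (intro; apply Hc; lra).
  assert (Hpair : forall s, -1 < s < 2 ->
    RInt (fun t => fst (df s t)) 0 b = 0 /\ RInt (fun t => snd (df s t)) 0 b = 0).
  { intros s Hs. specialize (H0 s Hs). rewrite C_RInt_eq in H0 by (intro; now apply Hdct).
    now injection H0. }
  f_equal.
  - apply (Hcomp fst).
    + intros; now apply is_derive_fst.
    + intros; now apply continuous_comp_fst.
    + intros s Hs; exact (proj1 (Hpair s Hs)).
  - apply (Hcomp snd).
    + intros; now apply is_derive_snd.
    + intros; now apply continuous_comp_snd.
    + intros s Hs; exact (proj2 (Hpair s Hs)).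
Qed.

(** * Circles, and contour integrals under contraction *)

Definition cis (t : R) : C := (cos t, sin t).

Definition circle (z : C) (r t : R) : C := (z + r * cis t)%C.

Lemma Cmod_cis (t : R) : Cmod (cis t) = 1.
Proof.
  unfold Cmod, cis; cbn [fst snd].
  replace (cos t ^ 2 + sin t ^ 2) with 1; [apply sqrt_1|].
  rewrite <- (sin2_cos2 t); unfold Rsqr; ring.
Qed.

Lemma cis_periodic : cis (2 * PI) = cis 0.
Proof. unfold cis. now rewrite cos_2PI, sin_2PI, cos_0, sin_0. Qed.

Lemma cis_is_derive (t : R) : C_is_derive cis t (Ci * cis t)%C.
Proof.
  eapply C_is_derive_eq.
  - apply (is_derive_pair (U := R_NormedModule) (V := R_NormedModule));
      [apply is_derive_cos|apply is_derive_sin].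
  - unfold cis, Ci, Cmult; cbn [fst snd]; f_equal; ring.
Qed.

Lemma cis_continuous (t : R) : continuous cis t.
Proof.
  apply (ex_derive_continuous (V := C_R_NormedModule)).
  eexists; apply cis_is_derive.
Qed.

Lemma scaled_cis_is_derive (r t : R) :
  C_is_derive (fun t => r * cis t)%C t (Ci * (r * cis t))%C.
Proof.
  eapply C_is_derive_eq.
  - apply C_is_derive_mult; [apply C_is_derive_const|apply cis_is_derive].
  - cbv beta; ring.
Qed.

Lemma circle_is_derive (z : C) (r t : R) :
  C_is_derive (circle z r) t (Ci * (r * cis t))%C.
Proof.
  eapply C_is_derive_eq.
  - apply C_is_derive_plus; [apply C_is_derive_const|apply scaled_cis_is_derive].
  - ring.
Qed.

Lemma circle_continuous (z : C) (r t : R) : continuous (circle z r) t.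
Proof.
  apply (ex_derive_continuous (V := C_R_NormedModule)).
  eexists; apply circle_is_derive.
Qed.

Lemma circle_periodic (z : C) (r : R) : circle z r (2 * PI) = circle z r 0.
Proof. unfold circle. now rewrite cis_periodic. Qed.

Lemma continuous_RtoC {T : UniformSpace} (f : T -> R) (x : T) :
  continuous f x -> continuous (fun t => RtoC (f t)) x.
Proof. intros Hf. apply continuous_pair; [easy|apply continuous_const]. Qed.

Ltac C_continuity :=
  unfold Cminus;
  lazymatch goal with
  | |- continuous (fun _ => ?c) _ => apply continuous_const
  | |- continuous (fun t => t) _ => apply continuous_id
  | |- continuous (fun t => fst t) _ => apply continuous_fst
  | |- continuous (fun t => snd t) _ => apply continuous_snd
  | |- continuous (fun t => RtoC (@?f t)) _ => apply (continuous_RtoC f); C_continuity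
  | |- continuous (fun t => cis (@?f t)) _ =>
      apply (continuous_comp f cis); [C_continuity|apply cis_continuous]
  | |- continuous (fun t => circle ?z ?r (@?f t)) _ =>
      apply (continuous_comp f (circle z r)); [C_continuity|apply circle_continuous]
  | |- continuous (fun t => Cmult (@?f t) (@?g t)) _ =>
      apply (continuous_Cmult f g); C_continuity
  | |- continuous (fun t => Cplus (@?f t) (@?g t)) _ =>
      apply (continuous_Cplus f g); C_continuity
  | |- continuous (fun t => Copp (@?f t)) _ => apply (continuous_Copp f); C_continuity
  | |- continuous (fun t => Cinv (@?f t)) _ =>
      apply (continuous_Cinv f); [C_continuity|try assumption]
  | |- _ => try assumption
  end.

Lemma Cmod_scaled_cis (r t : R) : 0 < r -> Cmod (r * cis t) = r.
Proof. intros Hr. rewrite Cmod_mult, Cmod_cis, Cmod_R, Rabs_pos_eq; lra. Qed.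

Lemma Cmod_sub_lower (a b : C) : Cmod a - Cmod b <= Cmod (a - b).
Proof.
  pose proof (Cmod_triangle (a - b) b).
  replace (a - b + b)%C with a in H by ring. lra.
Qed.

Lemma Cmod_pos_neq_0 (z : C) : 0 < Cmod z -> z <> 0.
Proof. apply Cmod_gt_0. Qed.

Lemma circle_sub (z w : C) (r t : R) :
  (circle z r t - w)%C = (r * cis t - (w - z))%C.
Proof. unfold circle; ring. Qed.

Lemma circle_sub_lower (z w : C) (r t : R) :
  0 < r -> r - Cmod (w - z) <= Cmod (circle z r t - w).
Proof.
  intros Hr. rewrite circle_sub.
  pose proof (Cmod_sub_lower (r * cis t) (w - z)) as H.
  rewrite (Cmod_scaled_cis r t Hr) in H. exact H.
Qed.

Lemma circle_sub_neq_0 (z w : C) (r t : R) :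
  0 < r -> Cmod (w - z) < r -> (circle z r t - w)%C <> 0.
Proof.
  intros Hr Hw. apply Cmod_pos_neq_0.
  pose proof (circle_sub_lower z w r t Hr). lra.
Qed.

(** The pole is moved from [w] to the centre along [s * w]; at [s = 0] the integrand is constantly
    1. The bound [r / 2] keeps the pole inside the circle for all [s] between -1 and 2. *)
Lemma winding_integral (r : R) (w : C) :
  0 < r -> Cmod w < r / 2 ->
  C_RInt (fun t => r * cis t * / (r * cis t - w))%C 0 (2 * PI) = RtoC (2 * PI).
Proof.
  intros Hr Hw.
  set (f := fun s t : R => (r * cis t * / (r * cis t - s * w))%C).
  assert (Hn : forall s t : R, -1 < s < 2 -> (r * cis t - s * w)%C <> 0).
  { intros s t Hs. apply Cmod_pos_neq_0.
    pose proof (Cmod_sub_lower (r * cis t) (s * w)) as H.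
    rewrite (Cmod_scaled_cis r t Hr), Cmod_mult, Cmod_R in H.
    assert (Rabs s < 2) by (apply Rabs_def1; lra).
    pose proof (Cmod_ge_0 w). pose proof (Rabs_pos s). nra. }
  transitivity (C_RInt (f 1) 0 (2 * PI)).
  { apply C_RInt_ext. intro t. unfold f. do 2 f_equal. ring. }
  rewrite <- (C_RInt_param_constant f
    (fun s t => r * cis t * (w * (/ (r * cis t - s * w) * / (r * cis t - s * w))))%C).
  - transitivity (C_RInt (fun _ => RtoC 1) 0 (2 * PI)).
    + apply C_RInt_ext. intro t. unfold f. replace (r * cis t - 0 * w)%C with (r * cis t)%C by ring.
      apply Cinv_r. pose proof (Hn 0 t ltac:(lra)) as H.
      now replace (r * cis t - 0 * w)%C with (r * cis t)%C in H by ring.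
    + rewrite (C_RInt_FTC RtoC (fun _ => RtoC 1)).
      * unfold Cminus. rewrite RtoC_mult. ring.
      * apply C_is_derive_RtoC.
      * intro; apply continuous_const.
  - intros s t Hs. unfold f. eapply C_is_derive_eq.
    + apply C_is_derive_mult; [apply C_is_derive_const|].
      apply C_is_derive_inv; [|exact (Hn s t Hs)].
      apply C_is_derive_plus; [apply C_is_derive_const|].
      apply C_is_derive_opp, C_is_derive_mult; [apply C_is_derive_RtoC|apply C_is_derive_const].
    + cbv beta; ring.
  - intros s t Hs. pose proof (Hn s t Hs). unfold Cminus in *. C_continuity.
  - intros s t Hs. pose proof (Hn s t Hs). unfold f, Cminus in *. C_continuity.
  - intros s Hs.
    (* A primitive in [t] of the derivative in [s]; it has period [2 * PI], so its increment is
       zero. *)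
    rewrite (C_RInt_FTC (fun t => Ci * w * / (r * cis t - s * w))%C).
    + rewrite cis_periodic. ring.
    + intro t. eapply C_is_derive_eq.
      * apply C_is_derive_mult; [apply C_is_derive_const|].
        apply C_is_derive_inv; [|exact (Hn s t Hs)].
        apply C_is_derive_plus; [apply scaled_cis_is_derive|apply C_is_derive_const].
      * cbv beta.
        transitivity (- (Ci * Ci) * (r * cis t * (w * (/ (r * cis t - s * w) * / (r * cis t - s * w)))))%C.
        { ring. }
        replace (Ci * Ci)%C with (- RtoC 1)%C; [ring|].
        unfold Ci, Cmult, Copp, RtoC; cbn [fst snd]; f_equal; ring.
    + intro t. pose proof (Hn s t Hs). unfold Cminus in *. C_continuity.
Qed.

(** The argument of [g] is contracted to [w] along the segments [c s t], while the kernel [K] stays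
    fixed. At [s = 0] what remains is [g w] times the winding integral. For [s] between -1 and 2 one
    has [|c s t - z| <= |1 - s| |w - z| + |s| r < 3 r], which explains the radii [3 * r] and
    [r / 2]. *)
Lemma cauchy_formula (D : C -> Prop) (g g' : C -> C) (z w : C) (r : R) :
  open D -> holomorphic_on D g g' -> 0 < r ->
  (forall u, Cmod (u - z) < 3 * r -> D u) -> Cmod (w - z) < r / 2 ->
  C_RInt (fun t => g (circle z r t) * (r * cis t) * / (circle z r t - w))%C 0 (2 * PI)
  = (RtoC (2 * PI) * g w)%C.
Proof.
  intros HD Hg Hr Hball Hw.
  set (K := fun t : R => (r * cis t * / (circle z r t - w))%C).
  set (c := fun s t : R => (w + s * (circle z r t - w))%C).
  set (f := fun s t : R => (g (c s t) * K t)%C).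
  assert (Hn : forall t, (circle z r t - w)%C <> 0) by (intro; apply circle_sub_neq_0; lra).
  assert (HK : forall t, continuous K t).
  { intro t. pose proof (Hn t). unfold K, Cminus in *. C_continuity. }
  assert (HcD : forall s t, -1 < s < 2 -> D (c s t)).
  { intros s t Hs. apply Hball.
    replace (c s t - z)%C with (RtoC (1 - s) * (w - z) + s * (r * cis t))%C.
    2:{ unfold c, circle. rewrite RtoC_minus. ring. }
    eapply Rle_lt_trans; [apply Cmod_triangle|].
    rewrite !(Cmod_mult (RtoC _) (_ - _)), (Cmod_mult s), (Cmod_scaled_cis r t Hr), !Cmod_R.
    assert (Rabs (1 - s) < 2) by (apply Rabs_def1; lra).
    assert (Rabs s < 2) by (apply Rabs_def1; lra).
    pose proof (Cmod_ge_0 (w - z)). pose proof (Rabs_pos s). pose proof (Rabs_pos (1 - s)).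
    nra. }
  assert (HEK : forall t, ((circle z r t - w) * K t)%C = (r * cis t)%C).
  { intro t. unfold K. field. apply Hn. }
  assert (Hcc : forall s t : R, continuous (fun p : R * R => c (fst p) (snd p)) (s, t)).
  { intros s t. unfold c, Cminus. C_continuity. }
  transitivity (C_RInt (f 1) 0 (2 * PI)).
  { apply C_RInt_ext. intro t. unfold f, K, c.
    replace (w + 1 * (circle z r t - w))%C with (circle z r t) by ring. ring. }
  rewrite <- (C_RInt_param_constant f (fun s t => r * cis t * g' (c s t))%C).
  - transitivity (C_RInt (fun t => g w * K t)%C 0 (2 * PI)).
    { apply C_RInt_ext. intro t. unfold f, c.
      now replace (w + 0 * (circle z r t - w))%C with w by ring. }
    rewrite C_RInt_mult_l by easy.
    rewrite (C_RInt_ext _ (fun t => r * cis t * / (r * cis t - (w - z)))%C).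
    + rewrite winding_integral by easy. ring.
    + intro t. unfold K. now rewrite circle_sub.
  - intros s t Hs. unfold f. eapply C_is_derive_eq.
    + apply C_is_derive_mult; [|apply C_is_derive_const].
      apply (holomorphic_comp D g g' (fun u => c u t)); [easy|easy|now apply HcD|].
      apply C_is_derive_plus; [apply C_is_derive_const|].
      apply C_is_derive_mult; [apply C_is_derive_RtoC|apply C_is_derive_const].
    + cbv beta. rewrite <- (HEK t). unfold c. ring.
  - intros s t Hs. apply continuous_Cmult; [C_continuity|].
    apply (continuous_comp (fun p : R * R => c (fst p) (snd p)) g'); [apply Hcc|].
    now apply Hg, HcD.
  - intros s t Hs. unfold f. apply continuous_Cmult; [|apply HK].
    apply (continuous_comp (c s) g).
    + unfold c, Cminus. C_continuity.
    + now apply (holomorphic_continuous D g g'), HcD.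
  - (* For [s <> 0], [d/ds] of the integrand is [d/dt] of [g (c s t) / (i s)], periodic in [t]. *)
    intros s Hs.
    assert (Hdc : forall t, continuous (fun t => r * cis t * g' (c s t))%C t).
    { intro t. apply continuous_Cmult; [C_continuity|].
      apply (continuous_comp (c s) g').
      + unfold c, Cminus. C_continuity.
      + now apply Hg, HcD. }
    assert (Hi : (Ci * Ci)%C = (- RtoC 1)%C).
    { unfold Ci, Cmult, Copp, RtoC; cbn [fst snd]; f_equal; ring. }
    (* At [s = 0] the general primitive would divide by zero, but there the curve is constant and
       the integrand is [g' w] times [r * cis t]. *)
    destruct (Req_dec s 0) as [->|Hs0].
    + rewrite (C_RInt_FTC (fun t => - Ci * g' w * (r * cis t))%C).
      * rewrite cis_periodic. ring.
      * intro t. eapply C_is_derive_eq.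
        { apply C_is_derive_mult; [apply C_is_derive_const|apply scaled_cis_is_derive]. }
        cbv beta. unfold c.
        replace (w + 0 * (circle z r t - w))%C with w by ring.
        transitivity (- (Ci * Ci) * (r * cis t * g' w))%C; [ring|]. rewrite Hi. ring.
      * exact Hdc.
    + assert (Hs0' : RtoC s <> 0) by (intro E; apply Hs0; now injection E).
      rewrite (C_RInt_FTC (fun t => - Ci * / s * g (c s t))%C).
      * unfold c. rewrite circle_periodic. ring.
      * intro t. eapply C_is_derive_eq.
        { apply C_is_derive_mult; [apply C_is_derive_const|].
          apply (holomorphic_comp D g g' (c s)); [easy|easy|now apply HcD|].
          apply C_is_derive_plus; [apply C_is_derive_const|].
          apply C_is_derive_mult; [apply C_is_derive_const|].
          apply C_is_derive_plus; [apply circle_is_derive|apply C_is_derive_const]. }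
        cbv beta.
        transitivity (- (Ci * Ci) * (s * / s) * (r * cis t * g' (c s t)))%C; [ring|].
        rewrite Hi, Cinv_r by easy. ring.
      * exact Hdc.
Qed.

(** * Cauchy-type integrals *)

(** Up to the factor [n!] this is the [n]-th derivative in [w] of the Cauchy transform of [h]. The
    density is arbitrary, so the family is stable both under differentiation and under removing a
    factor [w - z]. *)
Definition cauchy_integral (z : C) (r : R) (h : R -> C) (n : nat) (w : C) : C :=
  C_RInt (fun t => h t * (/ (circle z r t - w)) ^ S n)%C 0 (2 * PI).

Lemma continuous_Cpow {T : UniformSpace} (f : T -> C) (n : nat) (x : T) :
  continuous f x -> continuous (fun t => (f t ^ n)%C) x.
Proof.
  intros Hf. induction n as [|n IH]; [apply continuous_const|].
  now apply (continuous_Cmult f).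
Qed.

Lemma cauchy_integrand_continuous (z w : C) (r : R) (h : R -> C) (n : nat) (t : R) :
  0 < r -> Cmod (w - z) < r -> (forall t, continuous h t) ->
  continuous (fun t => h t * (/ (circle z r t - w)) ^ n)%C t.
Proof.
  intros Hr Hw Hh. pose proof (circle_sub_neq_0 z w r t Hr Hw) as Hn.
  unfold Cminus in *.
  apply continuous_Cmult; [easy|]. apply continuous_Cpow. C_continuity.
Qed.

Lemma continuous_Cmod {T : UniformSpace} (f : T -> C) (x : T) :
  continuous f x -> continuous (fun t => Cmod (f t)) x.
Proof.
  intros Hf. unfold Cmod. apply (continuous_comp _ sqrt); [|apply continuous_sqrt].
  apply continuous_ext with (f := fun t => Re (f t) * Re (f t) + Im (f t) * Im (f t)).
  { intro t; unfold Re, Im; simpl; ring. }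
  pose proof (continuous_Re f x Hf). pose proof (continuous_Im f x Hf).
  apply continuous_Rplus; now apply continuous_Rmult.
Qed.

Lemma C_bounded_segment (h : R -> C) (a b : R) :
  a <= b -> (forall t, continuous h t) ->
  exists M, 0 <= M /\ forall t, a <= t <= b -> Cmod (h t) <= M.
Proof.
  intros Hab Hh.
  destruct (continuity_ab_maj (fun t => Cmod (h t)) a b Hab) as [m [Hm _]].
  - intros t _. apply continuity_pt_filterlim. now apply (continuous_Cmod h).
  - exists (Cmod (h m)); split; [apply Cmod_ge_0|exact Hm].
Qed.

(** [a] and [b] stand for the kernels [/ (zeta - u)] and [/ (zeta - w)], with [d = u - w]; the
    conclusion is a second-order Taylor bound for their powers. As [M] depends only on [n] and [K],
    the bound can be integrated over the circle. *)
Lemma cauchy_kernel_pow_bound (n : nat) (K : R) :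
  0 <= K ->
  exists M, 0 <= M /\ forall a b d : C,
    Cmod a <= K -> Cmod b <= K -> (a - b)%C = (d * a * b)%C ->
    Cmod (a ^ n - b ^ n - INR n * d * b ^ S n) <= M * Cmod d ^ 2.
Proof.
  intros HK. induction n as [|n [M [HM IH]]].
  - exists 0; split; [lra|]. intros a b d _ _ _. cbn [Cpow INR].
    replace (1 - 1 - 0 * d * (b * 1))%C with (RtoC 0) by ring.
    rewrite Cmod_0. lra.
  - exists (K * M + INR (S n) * K ^ (n + 3)). split.
    { pose proof (pos_INR (S n)). pose proof (pow_le K (n + 3) HK). nra. }
    intros a b d Ha Hb Hd. specialize (IH a b d Ha Hb Hd).
    (* The old remainder is multiplied by [a]; replacing each new difference [a - b] by [d * a * b]
       leaves one extra term, of second order in [d]. *)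
    replace (a ^ S n - b ^ S n - INR (S n) * d * b ^ S (S n))%C with
      (a * (a ^ n - b ^ n - INR n * d * b ^ S n)
       + INR (S n) * d ^ 2 * (a * b ^ (n + 2)))%C.
    2:{ replace (n + 2)%nat with (S (S n)) by lia.
        rewrite S_INR, RtoC_plus. cbn [Cpow].
        assert (E0 : (a - b - d * a * b)%C = 0) by (rewrite <- Hd; ring).
        transitivity (a * (a ^ n - b ^ n - INR n * d * (b * b ^ n))
          + (INR n + 1) * (d * (d * 1)) * (a * (b * (b * b ^ n)))
          + b ^ n * (1 + (INR n + 1) * d * b) * (a - b - d * a * b))%C;
          [rewrite E0|]; ring. }
    eapply Rle_trans; [apply Cmod_triangle|].
    rewrite !Cmod_mult, !Cmod_pow, Cmod_R, (Rabs_pos_eq (INR (S n))) by apply pos_INR.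
    assert (H1 : Cmod b ^ (n + 2) <= K ^ (n + 2)).
    { apply pow_incr. split; [apply Cmod_ge_0|easy]. }
    assert (H2 : Cmod a * Cmod b ^ (n + 2) <= K ^ (n + 3)).
    { replace (K ^ (n + 3)) with (K * K ^ (n + 2)) by (replace (n + 3)%nat with (S (n + 2)) by lia; reflexivity).
      apply Rmult_le_compat; try easy; [apply Cmod_ge_0|apply pow_le, Cmod_ge_0]. }
    assert (H3 : Cmod a * Cmod (a ^ n - b ^ n - INR n * d * b ^ S n) <= K * (M * Cmod d ^ 2)).
    { apply Rmult_le_compat; try easy; apply Cmod_ge_0. }
    assert (H4 : INR (S n) * Cmod d ^ 2 * (Cmod a * Cmod b ^ (n + 2))
                 <= INR (S n) * Cmod d ^ 2 * K ^ (n + 3)).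
    { apply Rmult_le_compat_l; [|easy].
      apply Rmult_le_pos; [apply pos_INR|apply pow_le, Cmod_ge_0]. }
    cbn [Cpow] in *. lra.
Qed.

(** A complex derivative with quadratic remainder; this single estimate yields both partial
    derivatives and continuity. *)
Definition quadratic_approx (g : C -> C) (w l : C) : Prop :=
  exists M delta, 0 <= M /\ 0 < delta /\ forall u, Cmod (u - w) < delta ->
    Cmod (g u - g w - l * (u - w)) <= M * Cmod (u - w) ^ 2.

Lemma C_is_derive_quadratic (f : R -> C) (x : R) (l : C) (M delta : R) :
  0 <= M -> 0 < delta ->
  (forall t, Rabs (t - x) < delta ->
     Cmod (f t - f x - RtoC (t - x) * l) <= M * Rabs (t - x) ^ 2) ->
  C_is_derive f x l.
Proof.
  intros HM Hd H. split; [apply is_linear_scal_l|].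
  intros y Hy. apply (is_filter_lim_locally_unique (V := AbsRing_NormedModule R_AbsRing)) in Hy.
  subst y.
  intros eps.
  assert (He : 0 < Rmin delta (eps / (M + 1))).
  { apply Rmin_pos; [easy|]. apply Rdiv_lt_0_compat; [apply cond_pos|lra]. }
  exists (mkposreal _ He). intros t Ht.
  change (Rabs (t - x) < Rmin delta (eps / (M + 1))) in Ht.
  assert (H1 : Rabs (t - x) < delta) by (eapply Rlt_le_trans; [exact Ht|apply Rmin_l]).
  assert (H2 : Rabs (t - x) < eps / (M + 1)) by (eapply Rlt_le_trans; [exact Ht|apply Rmin_r]).
  specialize (H t H1).
  match goal with |- norm ?a <= _ => replace (norm a) with (Cmod (f t - f x - RtoC (t - x) * l)) end.
  2:{ rewrite Cmod_norm. f_equal. destruct (f t), (f x), l.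
      unfold minus, plus, opp, scal, RtoC, Cminus, Cplus, Copp, Cmult; simpl.
      unfold prod_scal, scal, prod_plus, prod_opp, plus, opp; simpl.
      unfold mult, plus, opp; simpl. f_equal; ring. }
  eapply Rle_trans; [exact H|].
  change (norm (minus t x)) with (Rabs (t - x)).
  assert (H3 : (M + 1) * Rabs (t - x) < eps).
  { apply Rmult_lt_compat_l with (r := M + 1) in H2; [|lra].
    replace ((M + 1) * (eps / (M + 1))) with (pos eps) in H2 by (field; lra). exact H2. }
  pose proof (Rabs_pos (t - x)). nra.
Qed.

(** Applied to the two coordinate lines through [w], whose directions [d] are [1] and [Ci]. *)
Lemma quadratic_approx_partial (g : C -> C) (w l d : C) (c : R -> C) (x : R) :
  quadratic_approx g w l -> c x = w -> Cmod d = 1 ->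
  (forall t, (c t - c x)%C = (RtoC (t - x) * d)%C) ->
  C_is_derive (fun t => g (c t)) x (d * l)%C.
Proof.
  intros (M & delta & HM & Hdel & H) Hx Hd Hc.
  apply (C_is_derive_quadratic _ _ _ M delta HM Hdel).
  intros t Ht. rewrite Hx in *.
  assert (E : Cmod (c t - w) = Rabs (t - x)) by (rewrite Hc, Cmod_mult, Hd, Cmod_R; ring).
  specialize (H (c t)). rewrite E, Hc in H.
  replace (RtoC (t - x) * (d * l))%C with (l * (RtoC (t - x) * d))%C by ring. auto.
Qed.

Lemma quadratic_approx_continuous (g : C -> C) (w l : C) :
  quadratic_approx g w l -> continuous g w.
Proof.
  intros (M & delta & HM & Hdel & H).
  apply filterlim_locally. intros eps.
  apply locally_Cmod.
  pose proof (Cmod_ge_0 l) as Hl.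
  exists (Rmin delta (Rmin 1 (eps / (Cmod l + M + 1)))). split.
  { repeat apply Rmin_pos; try lra. apply Rdiv_lt_0_compat; [apply cond_pos|lra]. }
  intros u Hu.
  pose proof (Rmin_l delta (Rmin 1 (eps / (Cmod l + M + 1)))).
  pose proof (Rmin_r delta (Rmin 1 (eps / (Cmod l + M + 1)))).
  pose proof (Rmin_l 1 (eps / (Cmod l + M + 1))).
  pose proof (Rmin_r 1 (eps / (Cmod l + M + 1))).
  specialize (H u ltac:(lra)).
  apply C_NormedModule_mixin_compat1. change (Cmod (g u - g w) < eps).
  assert (E : Cmod (g u - g w) <= Cmod (g u - g w - l * (u - w)) + Cmod l * Cmod (u - w)).
  { rewrite <- Cmod_mult. eapply Rle_trans; [|apply Cmod_triangle]. right. f_equal. ring. }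
  pose proof (Cmod_ge_0 (u - w)).
  assert (Hlt : (Cmod l + M + 1) * Cmod (u - w) < eps).
  { assert (Hq : Cmod (u - w) < eps / (Cmod l + M + 1)) by lra.
    apply Rmult_lt_compat_l with (r := Cmod l + M + 1) in Hq; [|lra].
    replace ((Cmod l + M + 1) * (eps / (Cmod l + M + 1))) with (pos eps) in Hq by (field; lra).
    exact Hq. }
  assert (Cmod (u - w) ^ 2 <= Cmod (u - w)) by nra. nra.
Qed.

Lemma cauchy_integral_quadratic (z w : C) (r : R) (h : R -> C) (n : nat) :
  0 < r -> Cmod (w - z) < r -> (forall t, continuous h t) ->
  quadratic_approx (cauchy_integral z r h n) w
    (INR (S n) * cauchy_integral z r h (S n) w).
Proof.
  intros Hr Hw Hh.
  (* Half the distance from [w] to the circle: any [u] within [e] of [w] is still at distance at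
     least [e] from the circle, so the kernels at both points are bounded by [/ e]. *)
  set (e := (r - Cmod (w - z)) / 2). assert (He : 0 < e) by (unfold e; lra).
  assert (HK : 0 <= / e) by (left; now apply Rinv_0_lt_compat).
  destruct (cauchy_kernel_pow_bound (S n) (/ e) HK) as (M & HM & HMb).
  assert (HPI : 0 <= 2 * PI) by (pose proof PI_RGT_0; lra).
  destruct (C_bounded_segment h 0 (2 * PI) HPI Hh) as (H & HH & HHb).
  exists ((2 * PI - 0) * (H * M)), e. split; [|split; [easy|]].
  { assert (0 <= H * M) by now apply Rmult_le_pos. nra. }
  intros u Hu.
  assert (Hu' : Cmod (u - z) <= Cmod (w - z) + e).
  { replace (u - z)%C with ((w - z) + (u - w))%C by ring.
    pose proof (Cmod_triangle (w - z) (u - w)). lra. }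
  assert (Hur : Cmod (u - z) < r) by (unfold e in *; lra).
  assert (Hinv : forall v t, Cmod (v - z) <= Cmod (w - z) + e ->
    Cmod (/ (circle z r t - v)) <= / e).
  { intros v t Hv. assert (Hvr : Cmod (v - z) < r) by (unfold e in *; lra).
    rewrite Cmod_inv by now apply circle_sub_neq_0.
    apply Rinv_le_contravar; [easy|].
    pose proof (circle_sub_lower z v r t Hr). unfold e in *; lra. }
  set (ku := fun t => (/ (circle z r t - u))%C). set (kw := fun t => (/ (circle z r t - w))%C).
  assert (Hcu : forall m t, continuous (fun t => h t * ku t ^ m)%C t).
  { intros; now apply cauchy_integrand_continuous. }
  assert (Hcw : forall m t, continuous (fun t => h t * kw t ^ m)%C t).
  { intros; now apply cauchy_integrand_continuous. }
  set (d := (u - w)%C).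
  assert (E : (cauchy_integral z r h n u - cauchy_integral z r h n w
               - INR (S n) * cauchy_integral z r h (S n) w * d)%C =
    C_RInt (fun t => h t * (ku t ^ S n - kw t ^ S n - INR (S n) * d * kw t ^ S (S n)))%C 0 (2 * PI)).
  { unfold cauchy_integral.
    transitivity (C_RInt (fun t => h t * ku t ^ S n)%C 0 (2 * PI)
      + (- RtoC 1 * C_RInt (fun t => h t * kw t ^ S n)%C 0 (2 * PI)
         + - (INR (S n) * d) * C_RInt (fun t => h t * kw t ^ S (S n))%C 0 (2 * PI)))%C.
    { unfold ku, kw. cbv beta. ring. }
    rewrite <- !C_RInt_mult_l by apply Hcw.
    rewrite <- C_RInt_plus, <- C_RInt_plus.
    - apply C_RInt_ext. intro t. ring.
    - apply Hcu.
    - intro t. apply continuous_Cplus; apply continuous_Cmult; try apply continuous_const; apply Hcw.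
    - intro t. apply continuous_Cmult; [apply continuous_const|apply Hcw].
    - intro t. apply continuous_Cmult; [apply continuous_const|apply Hcw]. }
  fold d. rewrite E.
  replace ((2 * PI - 0) * (H * M) * Cmod d ^ 2) with ((2 * PI - 0) * (H * (M * Cmod d ^ 2))) by ring.
  apply C_RInt_bound; [easy| |].
  - intro t. apply continuous_ext with (f := fun t =>
      (h t * ku t ^ S n + (- RtoC 1 * (h t * kw t ^ S n)
        + - (INR (S n) * d) * (h t * kw t ^ S (S n))))%C).
    { intro s. match goal with |- ?a = ?b => change (@eq C a b) end. ring. }
    apply continuous_Cplus; [apply Hcu|].
    apply continuous_Cplus; apply continuous_Cmult; try apply continuous_const; apply Hcw.
  - intros t Ht. rewrite Cmod_mult.
    apply Rmult_le_compat; [apply Cmod_ge_0|apply Cmod_ge_0|now apply HHb|].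
    apply HMb.
    + now apply Hinv.
    + apply Hinv; lra.
    + unfold ku, kw, d. pose proof (circle_sub_neq_0 z u r t Hr Hur).
      pose proof (circle_sub_neq_0 z w r t Hr Hw). field. now split.
Qed.

Lemma cauchy_integral_continuous (z w : C) (r : R) (h : R -> C) (n : nat) :
  0 < r -> Cmod (w - z) < r -> (forall t, continuous h t) ->
  continuous (cauchy_integral z r h n) w.
Proof.
  intros Hr Hw Hh. eapply quadratic_approx_continuous.
  now apply cauchy_integral_quadratic.
Qed.

Lemma cauchy_integral_partial1 (z w : C) (r : R) (h : R -> C) (n : nat) :
  0 < r -> Cmod (w - z) < r -> (forall t, continuous h t) ->
  C_is_derive (fun t : R => cauchy_integral z r h n (t, snd w)) (fst w)
    (INR (S n) * cauchy_integral z r h (S n) w)%C.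
Proof.
  intros Hr Hw Hh. eapply C_is_derive_eq.
  - apply (quadratic_approx_partial _ w (INR (S n) * cauchy_integral z r h (S n) w)%C 1
             (fun t : R => (t, snd w))).
    + now apply cauchy_integral_quadratic.
    + now destruct w.
    + apply Cmod_1.
    + intro t. unfold RtoC, Cminus, Cplus, Copp, Cmult; cbn [fst snd]; f_equal; ring.
  - ring.
Qed.

Lemma cauchy_integral_partial2 (z w : C) (r : R) (h : R -> C) (n : nat) :
  0 < r -> Cmod (w - z) < r -> (forall t, continuous h t) ->
  C_is_derive (fun t : R => cauchy_integral z r h n (fst w, t)) (snd w)
    (Ci * (INR (S n) * cauchy_integral z r h (S n) w))%C.
Proof.
  intros Hr Hw Hh.
  apply (quadratic_approx_partial _ w (INR (S n) * cauchy_integral z r h (S n) w)%C Ci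
           (fun t : R => (fst w, t))).
  - now apply cauchy_integral_quadratic.
  - now destruct w.
  - apply Cmod_Ci.
  - intro t. unfold RtoC, Ci, Cminus, Cplus, Copp, Cmult; cbn [fst snd]; f_equal; ring.
Qed.

(** One step of the geometric series: [1/(zeta - w) = 1/(zeta - z) + (w - z)/((zeta - z)(zeta -
    w))]. The remainder is again a Cauchy integral, with a new density, so the step can be
    iterated. *)
Lemma cauchy_integral_expand (z w : C) (r : R) (h : R -> C) :
  0 < r -> Cmod (w - z) < r -> (forall t, continuous h t) ->
  cauchy_integral z r h 0 w =
  (cauchy_integral z r h 0 z
   + (w - z) * cauchy_integral z r (fun t => h t * / (circle z r t - z)) 0 w)%C.
Proof.
  intros Hr Hw Hh.
  assert (Hz : Cmod (z - z) < r).
  { replace (z - z)%C with (RtoC 0) by ring. now rewrite Cmod_0. }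
  assert (Hh' : forall t, continuous (fun t => h t * / (circle z r t - z))%C t).
  { intro t. pose proof (circle_sub_neq_0 z z r t Hr Hz). unfold Cminus in *. C_continuity. apply Hh. }
  unfold cauchy_integral.
  rewrite <- C_RInt_mult_l by (intro; now apply (cauchy_integrand_continuous z w r _ 1)).
  rewrite <- C_RInt_plus.
  - apply C_RInt_ext. intro t. cbn [Cpow].
    pose proof (circle_sub_neq_0 z z r t Hr Hz). pose proof (circle_sub_neq_0 z w r t Hr Hw).
    field. now split.
  - intro; now apply (cauchy_integrand_continuous z z r _ 1).
  - intro t. apply continuous_Cmult; [apply continuous_const|].
    now apply (cauchy_integrand_continuous z w r _ 1).
Qed.

Lemma holomorphic_cauchy_integral (D : C -> Prop) (g g' : C -> C) (z : C) (r : R) :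
  open D -> holomorphic_on D g g' -> 0 < r ->
  (forall u, Cmod (u - z) < 3 * r -> D u) ->
  exists h, (forall t, continuous h t) /\
    forall w, Cmod (w - z) < r / 2 -> g w = cauchy_integral z r h 0 w.
Proof.
  intros HD Hg Hr Hball.
  (* On the circle [d zeta = i r cis t dt], so the usual factor [1 / (2 pi i)] becomes
     [1 / (2 pi)]. *)
  exists (fun t => / RtoC (2 * PI) * (g (circle z r t) * (r * cis t)))%C.
  assert (HPI : RtoC (2 * PI) <> 0).
  { intro E. injection E as E. pose proof PI_RGT_0. lra. }
  assert (Hgc : forall t, continuous (fun t => g (circle z r t)) t).
  { intro t. apply (continuous_comp (circle z r) g); [apply circle_continuous|].
    apply (holomorphic_continuous D g g'); [easy|easy|].
    apply Hball. unfold circle. replace (z + r * cis t - z)%C with (r * cis t)%C by ring.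
    rewrite Cmod_scaled_cis; lra. }
  assert (Hc : forall t, continuous (fun t => g (circle z r t) * (r * cis t))%C t).
  { intro t. apply continuous_Cmult; [apply Hgc|C_continuity]. }
  split.
  { intro t. apply continuous_Cmult; [apply continuous_const|apply Hc]. }
  intros w Hw. unfold cauchy_integral.
  assert (Hn : forall t, (circle z r t - w)%C <> 0) by (intro; apply circle_sub_neq_0; lra).
  transitivity (/ RtoC (2 * PI) * (RtoC (2 * PI) * g w))%C.
  { field. exact HPI. }
  rewrite <- (cauchy_formula D g g' z w r HD Hg Hr Hball Hw).
  rewrite <- C_RInt_mult_l.
  - apply C_RInt_ext. intro t. cbn [Cpow]. ring.
  - intro t. apply continuous_Cmult; [apply Hc|].
    specialize (Hn t). unfold Cminus in *. C_continuity.
Qed.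

(** * Taylor division and the zeros of holomorphic functions *)

Lemma small_geometric_zero (x : C) (M : R) :
  0 <= M -> (forall m, Cmod x <= M * (1 / 2) ^ m) -> x = 0.
Proof.
  intros HM H. apply Cmod_eq_0. apply Rle_antisym; [|apply Cmod_ge_0].
  apply Rnot_lt_le. intro Hp.
  assert (Hy : 0 < Cmod x / (M + 1)) by (apply Rdiv_lt_0_compat; lra).
  destruct (pow_lt_1_zero (1 / 2) ltac:(rewrite Rabs_pos_eq; lra) _ Hy) as [N HN].
  specialize (HN N (le_n N)). specialize (H N).
  assert (0 < (1 / 2) ^ N) by (apply pow_lt; lra).
  rewrite Rabs_pos_eq in HN by lra.
  apply Rmult_lt_compat_l with (r := M + 1) in HN; [|lra].
  replace ((M + 1) * (Cmod x / (M + 1))) with (Cmod x) in HN by (field; lra).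
  nra.
Qed.

(** Powers of [w - z] are divided out one at a time. If some Taylor coefficient at [z] is nonzero,
    the first such one gives [g w = (w - z)^m * rest m w] with [rest m] continuous and nonzero at
    [z]. If all vanish, this factorisation holds for every [m], and for [|w - z| < r / 2] it bounds
    [|g w|] by a constant times [(1 / 2)^m]. *)
Lemma holomorphic_zero_dichotomy (D : C -> Prop) (g g' : C -> C) (z : C) :
  open D -> holomorphic_on D g g' -> D z ->
  (exists eps, 0 < eps /\ forall w, Cmod (w - z) < eps -> g w = 0) \/
  (exists eps, 0 < eps /\ forall w, w <> z -> Cmod (w - z) < eps -> g w <> 0).
Proof.
  intros HD Hg Hz.
  destruct (open_ball_Cmod D z HD Hz) as (e & He & Hball).
  set (r := e / 3). assert (Hr : 0 < r) by (unfold r; lra).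
  assert (Hball' : forall u, Cmod (u - z) < 3 * r -> D u).
  { intros u Hu. apply Hball. unfold r in Hu. lra. }
  destruct (holomorphic_cauchy_integral D g g' z r HD Hg Hr Hball') as (h & Hh & Heq).
  assert (Hzz : Cmod (z - z) = 0).
  { replace (z - z)%C with (RtoC 0) by ring. apply Cmod_0. }
  set (q := fun t => (/ (circle z r t - z))%C).
  set (hm := fun (m : nat) t => (h t * q t ^ m)%C).
  assert (Hhm : forall m t, continuous (hm m) t).
  { intros m t. apply cauchy_integrand_continuous; [exact Hr|rewrite Hzz; exact Hr|exact Hh]. }
  (* The remainder of order [m]; its value at [z] is the [m]-th Taylor coefficient of [g]. *)
  set (rest := fun m => cauchy_integral z r (hm m) 0).
  assert (Hexp : forall m w, Cmod (w - z) < r ->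
    rest m w = (rest m z + (w - z) * rest (S m) w)%C).
  { intros m w Hw. unfold rest. rewrite (cauchy_integral_expand z w r (hm m)) by easy.
    do 2 f_equal. unfold cauchy_integral. apply C_RInt_ext. intro t. unfold hm, q.
    cbn [Cpow]. ring. }
  assert (Hfac : forall m w, (forall k, (k < m)%nat -> rest k z = 0) ->
    Cmod (w - z) < r / 2 -> g w = ((w - z) ^ m * rest m w)%C).
  { intros m w Hk Hw. induction m as [|m IH].
    - rewrite (Heq w Hw). cbn [Cpow]. unfold rest, cauchy_integral.
      rewrite Cmult_1_l. apply C_RInt_ext. intro t. unfold hm. cbn [Cpow]. ring.
    - rewrite IH by (intros; apply Hk; lia).
      rewrite (Hexp m w) by lra. rewrite (Hk m) by lia. cbn [Cpow]. ring. }
  destruct (classic (exists m, rest m z <> 0)) as [Hex|Hall].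
  - right.
    destruct (dec_inh_nat_subset_has_unique_least_element
      (fun m => rest m z <> 0) (fun m => classic _) Hex) as (m & (Hm & Hleast) & _).
    assert (Hk : forall k, (k < m)%nat -> rest k z = 0).
    { intros k Hk. apply NNPP. intro Hn. specialize (Hleast k Hn). lia. }
    assert (Hcont : continuous (rest m) z).
    { apply (cauchy_integral_continuous z z r (hm m) 0);
      [exact Hr|rewrite Hzz; exact Hr|exact (Hhm m)]. }
    assert (Hpos : 0 < Cmod (rest m z)) by now apply Cmod_gt_0.
    assert (Hloc : locally z (fun w => rest m w <> 0)).
    { apply (continuous_Cmod (rest m)) in Hcont.
      assert (Hgt : locally (Cmod (rest m z)) (fun y => 0 < y)) by now apply open_gt.
      pose proof (Hcont _ Hgt) as Hl. unfold filtermap in Hl.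
      revert Hl. apply filter_imp. intros w Hw. now apply Cmod_gt_0. }
    apply locally_Cmod in Hloc. destruct Hloc as (e' & He' & Hnz).
    exists (Rmin e' (r / 2)). split; [apply Rmin_pos; lra|].
    intros w Hwz Hw.
    pose proof (Rmin_l e' (r / 2)). pose proof (Rmin_r e' (r / 2)).
    rewrite (Hfac m w Hk) by lra.
    apply Cmult_neq_0; [|apply Hnz; lra].
    apply Cmod_gt_0. rewrite Cmod_pow. apply pow_lt. apply Cmod_gt_0.
    intro E. apply Hwz. replace w with ((w - z) + z)%C by ring. rewrite E. ring.
  - left. exists (r / 2). split; [lra|]. intros w Hw.
    assert (HPI : 0 <= 2 * PI) by (pose proof PI_RGT_0; lra).
    destruct (C_bounded_segment h 0 (2 * PI) HPI Hh) as (H & HH & HHb).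
    apply (small_geometric_zero _ ((2 * PI - 0) * (H * (2 / r)))).
    { apply Rmult_le_pos; [lra|]. apply Rmult_le_pos; [easy|].
      left. apply Rdiv_lt_0_compat; lra. }
    intro m.
    rewrite (Hfac m w) by (try easy; intros k _; apply NNPP; intro Hn; apply Hall; now exists k).
    rewrite Cmod_mult, Cmod_pow.
    (* On the circle the kernel at [z] has modulus exactly [/ r], and the kernel at [w] at most
       [2 / r]. *)
    assert (Hb : Cmod (rest m w) <= (2 * PI - 0) * (H * (/ r) ^ m * (2 / r))).
    { apply C_RInt_bound; [easy| |].
      - intro t. apply (cauchy_integrand_continuous z w r (hm m) 1); [exact Hr|lra|exact (Hhm m)].
      - intros t Ht. unfold hm. cbn [Cpow]. rewrite Cmult_1_r, !Cmod_mult, Cmod_pow.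
        assert (Hq : Cmod (q t) = / r).
        { unfold q. rewrite Cmod_inv by (apply circle_sub_neq_0; lra).
          unfold circle. replace (z + r * cis t - z)%C with (r * cis t)%C by ring.
          now rewrite Cmod_scaled_cis. }
        rewrite Hq.
        assert (Hi : 0 <= (/ r) ^ m) by (apply pow_le; left; now apply Rinv_0_lt_compat).
        apply Rmult_le_compat.
        + apply Rmult_le_pos; [apply Cmod_ge_0|easy].
        + apply Cmod_ge_0.
        + apply Rmult_le_compat_r; [easy|]. now apply HHb.
        + rewrite Cmod_inv by (apply circle_sub_neq_0; lra).
          replace (2 / r) with (/ (r / 2)) by (field; lra).
          apply Rinv_le_contravar; [lra|].
          pose proof (circle_sub_lower z w r t Hr). lra. }
    assert (Hp : Cmod (w - z) ^ m <= (r / 2) ^ m).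
    { apply pow_incr. split; [apply Cmod_ge_0|lra]. }
    eapply Rle_trans.
    { apply Rmult_le_compat; [apply pow_le, Cmod_ge_0|apply Cmod_ge_0|exact Hp|exact Hb]. }
    right. replace (1 / 2) with ((r / 2) * / r) by (field; lra).
    rewrite Rpow_mult_distr. ring.
Qed.

(** * Smoothness *)

(** Two families are allowed because the derivatives of generating functions need only lie in the
    larger family that they generate. *)
Definition closed_under_partials {V : NormedModule R_AbsRing}
    (U : R * R -> Prop) (S S' : (R * R -> V) -> Prop) : Prop :=
  forall g, S g ->
    (forall p, U p -> continuous g p) /\
    exists g1 g2, S' g1 /\ S' g2 /\
      forall p, U p -> is_partial1 g p (g1 p) /\ is_partial2 g p (g2 p).

Lemma closed_family_smooth {V : NormedModule R_AbsRing}
    (U : R * R -> Prop) (S : (R * R -> V) -> Prop) :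
  closed_under_partials U S S -> forall g, S g -> smooth U g.
Proof.
  intros HS g Hg k. revert g Hg. induction k as [|k IH]; intros g Hg.
  - exact (proj1 (HS g Hg)).
  - destruct (HS g Hg) as [_ (g1 & g2 & H1 & H2 & Hp)].
    exists g1, g2. split; [exact Hp|]. split; now apply IH.
Qed.

(** The functions obtained rationally from [B] and the coordinates, with denominators free of zeros
    on [U]. [rc_ext] admits functions known only on [U]: a component of [F] agrees with a Cauchy
    integral only near the centre of the circle. *)
Inductive rational_closure (U : R * R -> Prop) (B : (R * R -> R) -> Prop) :
    (R * R -> R) -> Prop :=
  | rc_base g : B g -> rational_closure U B g
  | rc_const c : rational_closure U B (fun _ => c)
  | rc_fst : rational_closure U B (fun p => fst p)
  | rc_snd : rational_closure U B (fun p => snd p)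
  | rc_plus g h : rational_closure U B g -> rational_closure U B h ->
      rational_closure U B (fun p => g p + h p)
  | rc_mult g h : rational_closure U B g -> rational_closure U B h ->
      rational_closure U B (fun p => g p * h p)
  | rc_inv g : rational_closure U B g -> (forall p, U p -> g p <> 0) ->
      rational_closure U B (fun p => / g p)
  | rc_ext g h : rational_closure U B g -> (forall p, U p -> g p = h p) ->
      rational_closure U B h.

Lemma rc_opp (U : R * R -> Prop) (B : (R * R -> R) -> Prop) (g : R * R -> R) :
  rational_closure U B g -> rational_closure U B (fun p => - g p).
Proof.
  intros Hg. apply rc_ext with (g := fun p => -1 * g p).
  - apply (rc_mult U B (fun _ => -1)); [apply rc_const|exact Hg].
  - intros; ring.
Qed.

Ltac rational :=
  unfold Rminus;
  lazymatch goal with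
  | |- rational_closure _ _ (fun _ => ?c) => apply rc_const
  | |- rational_closure _ _ (fun p => fst p) => apply rc_fst
  | |- rational_closure _ _ (fun p => snd p) => apply rc_snd
  | |- rational_closure ?U ?B (fun p => Rplus (@?g p) (@?h p)) =>
      apply (rc_plus U B g h); rational
  | |- rational_closure ?U ?B (fun p => Rmult (@?g p) (@?h p)) =>
      apply (rc_mult U B g h); rational
  | |- rational_closure ?U ?B (fun p => Ropp (@?g p)) =>
      apply (rc_opp U B g); rational
  | |- rational_closure ?U ?B (fun p => Rinv (@?g p)) =>
      apply (rc_inv U B g); [rational|]
  | |- _ => try assumption
  end.

Lemma open_section1 (U : R * R -> Prop) (p : R * R) :
  open U -> U p -> locally (fst p) (fun t => U (t, snd p)).
Proof.
  intros HU Hp. destruct p as [x y]. destruct (HU _ Hp) as [e He].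
  exists e. intros t Ht. apply He. split; [exact Ht|apply ball_center].
Qed.

Lemma open_section2 (U : R * R -> Prop) (p : R * R) :
  open U -> U p -> locally (snd p) (fun t => U (fst p, t)).
Proof.
  intros HU Hp. destruct p as [x y]. destruct (HU _ Hp) as [e He].
  exists e. intros t Ht. apply He. split; [apply ball_center|exact Ht].
Qed.

Lemma R_is_derive_const (c x : R) : is_derive (fun _ : R => c) x 0.
Proof. exact (is_derive_const (V := R_NormedModule) c (x : R_AbsRing)). Qed.

Lemma rational_closure_partials (U : R * R -> Prop) (B : (R * R -> R) -> Prop) :
  open U ->
  closed_under_partials (V := R_NormedModule) U B (rational_closure U B) ->
  closed_under_partials (V := R_NormedModule) U (rational_closure U B) (rational_closure U B).
Proof.
  intros HU HB g Hg.
  induction Hg as [g Hg|c| | |g h Hg [Cg (g1 & g2 & G1 & G2 & Pg)] Hh [Ch (h1 & h2 & H1 & H2 & Ph)]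
    |g h Hg [Cg (g1 & g2 & G1 & G2 & Pg)] Hh [Ch (h1 & h2 & H1 & H2 & Ph)]
    |g Hg [Cg (g1 & g2 & G1 & G2 & Pg)] Hn
    |g h Hg [Cg (g1 & g2 & G1 & G2 & Pg)] Hgh].
  - now apply HB.
  - split; [intros; apply continuous_const|].
    exists (fun _ => 0), (fun _ => 0). split; [rational|split; [rational|]].
    intros p _; split; [exact (R_is_derive_const c (fst p))|exact (R_is_derive_const c (snd p))].
  - split; [intros [x y] _; apply continuous_fst|].
    exists (fun _ => 1), (fun _ => 0). split; [rational|split; [rational|]].
    intros p _; split; [exact (is_derive_id (K := R_AbsRing) (fst p))
                       |exact (R_is_derive_const (fst p) (snd p))].
  - split; [intros [x y] _; apply continuous_snd|].
    exists (fun _ => 0), (fun _ => 1). split; [rational|split; [rational|]].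
    intros p _; split; [exact (R_is_derive_const (snd p) (fst p))
                       |exact (is_derive_id (K := R_AbsRing) (snd p))].
  - split; [intros; apply continuous_Rplus; auto|].
    exists (fun p => g1 p + h1 p), (fun p => g2 p + h2 p).
    split; [rational|split; [rational|]].
    intros p Hp; destruct (Pg p Hp), (Ph p Hp); split; now apply is_derive_Rplus.
  - split; [intros; apply continuous_Rmult; auto|].
    exists (fun p => g1 p * h p + g p * h1 p), (fun p => g2 p * h p + g p * h2 p).
    split; [rational|split; [rational|]].
    intros [x y] Hp; destruct (Pg _ Hp), (Ph _ Hp); split.
    + now apply (Derive.is_derive_mult (fun t => g (t, y)) (fun t => h (t, y))).
    + now apply (Derive.is_derive_mult (fun t => g (x, t)) (fun t => h (x, t))).
  - split; [intros; apply continuous_Rinv'; auto|].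
    exists (fun p => - g1 p * (/ g p * / g p)), (fun p => - g2 p * (/ g p * / g p)).
    split; [rational; exact Hn|split; [rational; exact Hn|]].
    intros [x y] Hp; specialize (Hn _ Hp); destruct (Pg _ Hp) as [P1 P2]; split.
    + eapply R_is_derive_eq; [apply (is_derive_inv (fun t => g (t, y)) x _ P1 Hn)|].
      simpl; field; exact Hn.
    + eapply R_is_derive_eq; [apply (is_derive_inv (fun t => g (x, t)) y _ P2 Hn)|].
      simpl; field; exact Hn.
  - split.
    (* Openness of [U] turns agreement on [U] into agreement near each of its points, which
       preserves continuity and derivatives. *)
    + intros p Hp. apply (continuous_ext_loc _ g); [|now apply Cg].
      generalize (HU p Hp). apply filter_imp. exact Hgh.
    + exists g1, g2. split; [easy|split; [easy|]].
      intros p Hp; destruct (Pg p Hp) as [P1 P2]; split.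
      * apply (is_derive_ext_loc (fun t => g (t, snd p))); [|exact P1].
        generalize (open_section1 U p HU Hp). apply filter_imp. intros t Ht; now apply Hgh.
      * apply (is_derive_ext_loc (fun t => g (fst p, t))); [|exact P2].
        generalize (open_section2 U p HU Hp). apply filter_imp. intros t Ht; now apply Hgh.
Qed.

Lemma rational_closure_quat_smooth (U : R * R -> Prop) (B : (R * R -> R) -> Prop)
    (a b c d : R * R -> R) :
  open U ->
  closed_under_partials (V := R_NormedModule) U B (rational_closure U B) ->
  rational_closure U B a -> rational_closure U B b ->
  rational_closure U B c -> rational_closure U B d ->
  smooth U (fun p => (a p, b p, c p, d p) : Quat).
Proof.
  intros HU HB Ha Hb Hc Hd.
  apply (closed_family_smooth (V := Quat_NormedModule) U (fun g => exists a b c d,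
    rational_closure U B a /\ rational_closure U B b /\
    rational_closure U B c /\ rational_closure U B d /\
    g = (fun p => (a p, b p, c p, d p)))).
  - clear a b c d Ha Hb Hc Hd.
    intros g (a & b & c & d & Ha & Hb & Hc & Hd & ->).
    pose proof (rational_closure_partials U B HU HB) as P.
    destruct (P a Ha) as [Ca (a1 & a2 & A1 & A2 & Pa)].
    destruct (P b Hb) as [Cb (b1 & b2 & B1 & B2 & Pb)].
    destruct (P c Hc) as [Cc (c1 & c2 & C1 & C2 & Pc)].
    destruct (P d Hd) as [Cd (d1 & d2 & D1 & D2 & Pd)].
    split.
    + intros p Hp. repeat apply continuous_pair; auto.
    + exists (fun p => (a1 p, b1 p, c1 p, d1 p)), (fun p => (a2 p, b2 p, c2 p, d2 p)).
      split; [now exists a1, b1, c1, d1|]. split; [now exists a2, b2, c2, d2|].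
      intros p Hp.
      destruct (Pa p Hp), (Pb p Hp), (Pc p Hp), (Pd p Hp).
      split; repeat apply is_derive_pair; assumption.
  - now exists a, b, c, d.
Qed.

Definition cauchy_components (z : C) (r : R) (g : R * R -> R) : Prop :=
  exists h n, (forall t, continuous h t) /\
    (g = (fun w => Re (cauchy_integral z r h n w)) \/
     g = (fun w => Im (cauchy_integral z r h n w))).

(** Differentiating raises the order from [n] to [S n]; in the second variable it also brings a
    factor [Ci], which exchanges real and imaginary parts up to sign. *)
Lemma cauchy_components_partials (z : C) (r : R) (U : R * R -> Prop) :
  0 < r -> (forall w : C, U w -> Cmod (w - z) < r) ->
  closed_under_partials (V := R_NormedModule) U (cauchy_components z r)
    (rational_closure U (cauchy_components z r)).
Proof.
  intros Hr HU g (h & n & Hh & Hg).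
  assert (Hre : rational_closure U (cauchy_components z r)
                  (fun w => Re (cauchy_integral z r h (S n) w))).
  { apply rc_base. exists h, (S n). auto. }
  assert (Him : rational_closure U (cauchy_components z r)
                  (fun w => Im (cauchy_integral z r h (S n) w))).
  { apply rc_base. exists h, (S n). auto. }
  destruct Hg as [-> | ->]; split.
  - intros p Hp. apply continuous_Re, cauchy_integral_continuous; auto.
  - exists (fun w => INR (S n) * Re (cauchy_integral z r h (S n) w)),
      (fun w => - INR (S n) * Im (cauchy_integral z r h (S n) w)).
    split; [rational|split; [rational|]].
    intros p Hp; specialize (HU p Hp); split.
    + eapply R_is_derive_eq.
      * exact (is_derive_fst _ _ _ (cauchy_integral_partial1 z p r h n Hr HU Hh)).
      * unfold Re, Cmult, RtoC; cbn [fst snd]; ring.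
    + eapply R_is_derive_eq.
      * exact (is_derive_fst _ _ _ (cauchy_integral_partial2 z p r h n Hr HU Hh)).
      * unfold Im, Cmult, RtoC, Ci; cbn [fst snd]; ring.
  - intros p Hp. apply continuous_Im, cauchy_integral_continuous; auto.
  - exists (fun w => INR (S n) * Im (cauchy_integral z r h (S n) w)),
      (fun w => INR (S n) * Re (cauchy_integral z r h (S n) w)).
    split; [rational|split; [rational|]].
    intros p Hp; specialize (HU p Hp); split.
    + eapply R_is_derive_eq.
      * exact (is_derive_snd _ _ _ (cauchy_integral_partial1 z p r h n Hr HU Hh)).
      * unfold Im, Cmult, RtoC; cbn [fst snd]; ring.
    + eapply R_is_derive_eq.
      * exact (is_derive_snd _ _ _ (cauchy_integral_partial2 z p r h n Hr HU Hh)).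
      * unfold Re, Cmult, RtoC, Ci; cbn [fst snd]; ring.
Qed.

(** * Quaternionic geometry *)

Definition q0 (x : Quat) : R := fst (fst (fst x)).
Definition q1 (x : Quat) : R := snd (fst (fst x)).
Definition q2 (x : Quat) : R := snd (fst x).
Definition q3 (x : Quat) : R := snd x.

(** What the four coordinates share, so that holomorphy and regularity of the components of [F] are
    proved once for all of them. *)
Definition coordinate_like (pr : Quat -> R) : Prop :=
  (forall (f : R -> Quat) x l, is_derive f x l -> is_derive (fun t => pr (f t)) x (pr l)) /\
  (forall (T : UniformSpace) (f : T -> Quat) x, continuous f x ->
     continuous (fun t => pr (f t)) x) /\
  (forall x, pr (qopp x) = - pr x) /\
  (forall x y, pr (plus x y) = pr x + pr y) /\
  (forall a x, pr (scal a x) = a * pr x).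

Lemma q0_coordinate : coordinate_like q0.
Proof.
  split; [|split; [|repeat split]].
  - intros f x l H. exact (is_derive_fst _ _ _ (is_derive_fst _ _ _ (is_derive_fst _ _ _ H))).
  - intros T f x H.
    exact (continuous_comp_fst _ _ (continuous_comp_fst _ _ (continuous_comp_fst _ _ H))).
Qed.

Lemma q1_coordinate : coordinate_like q1.
Proof.
  split; [|split; [|repeat split]].
  - intros f x l H. exact (is_derive_snd _ _ _ (is_derive_fst _ _ _ (is_derive_fst _ _ _ H))).
  - intros T f x H.
    exact (continuous_comp_snd _ _ (continuous_comp_fst _ _ (continuous_comp_fst _ _ H))).
Qed.

Lemma q2_coordinate : coordinate_like q2.
Proof.
  split; [|split; [|repeat split]].
  - intros f x l H. exact (is_derive_snd _ _ _ (is_derive_fst _ _ _ H)).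
  - intros T f x H. exact (continuous_comp_snd _ _ (continuous_comp_fst _ _ H)).
Qed.

Lemma q3_coordinate : coordinate_like q3.
Proof.
  split; [|split; [|repeat split]].
  - intros f x l H. exact (is_derive_snd _ _ _ H).
  - intros T f x H. exact (continuous_comp_snd _ _ H).
Qed.

Lemma quat_eq (a b c d a' b' c' d' : R) :
  a = a' -> b = b' -> c = c' -> d = d' -> (a, b, c, d) = (a', b', c', d') :> Quat.
Proof. now intros -> -> -> ->. Qed.

Lemma imag_unit_iff (J : Quat) :
  imag_unit J <->
  exists j1 j2 j3, J = (0, j1, j2, j3) /\ j1 * j1 + j2 * j2 + j3 * j3 = 1.
Proof.
  split.
  - destruct J as [[[a b] c] d]. unfold imag_unit, qmul, qreal. intro H.
    injection H as H0 H1 H2 H3.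
    (* The products of [a] with the imaginary coordinates vanish; if [a] were nonzero these would be
       zero, and [a * a = -1]. *)
    assert (a = 0) by nra. subst a. exists b, c, d. split; [easy|lra].
  - intros (j1 & j2 & j3 & -> & H). unfold imag_unit, qmul, qreal.
    apply quat_eq; lra.
Qed.

Lemma qadd_eq (a b c d a' b' c' d' : R) :
  qadd (a, b, c, d) (a', b', c', d') = (a + a', b + b', c + c', d + d').
Proof. reflexivity. Qed.

Lemma slice_point_eq (j1 j2 j3 alpha beta : R) :
  slice_point (0, j1, j2, j3) alpha beta = (alpha, beta * j1, beta * j2, beta * j3).
Proof.
  unfold slice_point, qmul, qreal. rewrite qadd_eq. apply quat_eq; ring.
Qed.

(** * The sphere over a point as a smooth surface *)

(** Put [w = b + eps * q3], so that the chart has the coordinates [s * w] and [t * w]. A vector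
    [(x, y)] killed by the differential leaves [q3], hence [w], unchanged to first order; the other
    two coordinates then give [x * w = 0] and [y * w = 0]. *)
Lemma stereographic_immersion (b eps : R) (phi : R * R -> Quat) :
  (forall p, q1 (phi p) = fst p * (b + eps * q3 (phi p))) ->
  (forall p, q2 (phi p) = snd p * (b + eps * q3 (phi p))) ->
  (forall p, 0 < b + eps * q3 (phi p)) ->
  immersive (fun _ => True) phi.
Proof.
  intros H1 H2 H3 [s t] l1 l2 _ P1 P2 x y Hxy.
  destruct q1_coordinate as (D1 & _), q2_coordinate as (D2 & _),
    q3_coordinate as (D3 & _).
  assert (E1 : x * q1 l1 + y * q1 l2 = 0) by exact (f_equal q1 Hxy).
  assert (E2 : x * q2 l1 + y * q2 l2 = 0) by exact (f_equal q2 Hxy).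
  assert (E3 : x * q3 l1 + y * q3 l2 = 0) by exact (f_equal q3 Hxy).
  unfold is_partial1 in P1; unfold is_partial2 in P2; cbn [fst snd] in P1, P2.
  assert (W1 : is_derive (fun u => b + eps * q3 (phi (u, t))) s (0 + eps * q3 l1)).
  { apply is_derive_Rplus; [apply R_is_derive_const|]. now apply is_derive_scal, D3. }
  assert (W2 : is_derive (fun u => b + eps * q3 (phi (s, u))) t (0 + eps * q3 l2)).
  { apply is_derive_Rplus; [apply R_is_derive_const|]. now apply is_derive_scal, D3. }
  assert (A11 : q1 l1 = 1 * (b + eps * q3 (phi (s, t))) + s * (0 + eps * q3 l1)).
  { rewrite <- (is_derive_unique _ _ _ (D1 _ _ _ P1)). apply is_derive_unique.
    apply is_derive_ext with (f := fun u => u * (b + eps * q3 (phi (u, t)))).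
    { intro u. now rewrite H1. }
    exact (Derive.is_derive_mult (fun u => u) _ s 1 _ (is_derive_id (K := R_AbsRing) s) W1). }
  assert (A12 : q1 l2 = s * (0 + eps * q3 l2)).
  { rewrite <- (is_derive_unique _ _ _ (D1 _ _ _ P2)). apply is_derive_unique.
    apply is_derive_ext with (f := fun u => s * (b + eps * q3 (phi (s, u)))).
    { intro u. now rewrite H1. }
    now apply is_derive_scal. }
  assert (A21 : q2 l1 = t * (0 + eps * q3 l1)).
  { rewrite <- (is_derive_unique _ _ _ (D2 _ _ _ P1)). apply is_derive_unique.
    apply is_derive_ext with (f := fun u => t * (b + eps * q3 (phi (u, t)))).
    { intro u. now rewrite H2. }
    now apply is_derive_scal. }
  assert (A22 : q2 l2 = 1 * (b + eps * q3 (phi (s, t))) + t * (0 + eps * q3 l2)).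
  { rewrite <- (is_derive_unique _ _ _ (D2 _ _ _ P2)). apply is_derive_unique.
    apply is_derive_ext with (f := fun u => u * (b + eps * q3 (phi (s, u)))).
    { intro u. now rewrite H2. }
    exact (Derive.is_derive_mult (fun u => u) _ t 1 _ (is_derive_id (K := R_AbsRing) t) W2). }
  specialize (H3 (s, t)). set (w := b + eps * q3 (phi (s, t))) in *.
  split.
  - apply Rmult_eq_reg_r with w; [|lra].
    transitivity ((x * q1 l1 + y * q1 l2) - s * eps * (x * q3 l1 + y * q3 l2)).
    + rewrite A11, A12. ring.
    + rewrite E1, E3. ring.
  - apply Rmult_eq_reg_r with w; [|lra].
    transitivity ((x * q2 l1 + y * q2 l2) - t * eps * (x * q3 l1 + y * q3 l2)).
    + rewrite A21, A22. ring.
    + rewrite E2, E3. ring.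
Qed.

Lemma slice_sphere_smooth (alpha beta : R) :
  0 < beta ->
  smooth_surface (fun x => exists J, imag_unit J /\ x = slice_point J alpha beta).
Proof.
  intros Hb x (J & HJ & Hx).
  apply imag_unit_iff in HJ. destruct HJ as (j1 & j2 & j3 & -> & Hj).
  rewrite slice_point_eq in Hx.
  (* The chart is stereographic projection from the pole with third coordinate [- eps] on the unit
     sphere; the sign puts [x] in the opposite closed hemisphere. *)
  assert (He : exists eps, eps * eps = 1 /\ 0 < beta + eps * (beta * j3)).
  { destruct (Rle_dec 0 j3).
    - exists 1. split; [ring|nra].
    - exists (-1). split; [ring|nra]. }
  destruct He as (eps & He & Hx3).
  set (k := fun p : R * R => / (1 + fst p * fst p + snd p * snd p)).
  set (phi := fun p : R * R =>
    (alpha, beta * (2 * fst p * k p), beta * (2 * snd p * k p),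
     eps * beta * (2 * k p - 1)) : Quat).
  set (psi := fun y : Quat =>
    (q1 y * / (beta + eps * q3 y), q2 y * / (beta + eps * q3 y))).
  assert (Hk : forall p : R * R, 0 < 1 + fst p * fst p + snd p * snd p).
  { intro p. nra. }
  assert (Hkpos : forall p, 0 < k p) by (intro; now apply Rinv_0_lt_compat).
  (* This is the common factor of the coordinates [q1] and [q2] of [phi p], so dividing by it in
     [psi] returns the parameters. *)
  assert (H3 : forall p, beta + eps * q3 (phi p) = 2 * beta * k p).
  { intro p. unfold q3, phi; cbn [fst snd].
    replace (beta + eps * (eps * beta * (2 * k p - 1)))
      with (beta + (eps * eps) * beta * (2 * k p - 1)) by ring.
    rewrite He; ring. }
  exists (fun y => 0 < beta + eps * q3 y), (fun _ => True), phi, psi.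
  split; [|split; [|split; [|split; [|split; [|split; [|split]]]]]].
  - intros y Hy.
    assert (Hc : continuous (fun y : Quat => beta + eps * q3 y) y).
    { apply continuous_Rplus; [apply continuous_const|].
      apply continuous_Rmult; [apply continuous_const|].
      apply (proj1 (proj2 q3_coordinate)), continuous_id. }
    exact (Hc _ (open_gt 0 _ Hy)).
  - rewrite Hx. exact Hx3.
  - apply open_true.
  - apply (rational_closure_quat_smooth _ (fun _ => False)
      (fun _ => alpha) (fun p => beta * (2 * fst p * k p))
      (fun p => beta * (2 * snd p * k p)) (fun p => eps * beta * (2 * k p - 1))).
    + apply open_true.
    + now intros g Hg.
    + rational.
    + unfold k. rational. intros p _. specialize (Hk p). lra.
    + unfold k. rational. intros p _. specialize (Hk p). lra.
    + unfold k. rational. intros p _. specialize (Hk p). lra.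
  - apply (stereographic_immersion beta eps).
    + intro p. rewrite H3. unfold q1, phi; cbn [fst snd]. ring.
    + intro p. rewrite H3. unfold q2, phi; cbn [fst snd]. ring.
    + intro p. rewrite H3. specialize (Hkpos p). nra.
  - intros p _. split; [|split].
    + exists (0, 2 * fst p * k p, 2 * snd p * k p, eps * (2 * k p - 1)). split.
      * apply imag_unit_iff. do 3 eexists. split; [reflexivity|].
        specialize (Hk p). unfold k.
        replace (eps * (2 * / (1 + fst p * fst p + snd p * snd p) - 1) *
          (eps * (2 * / (1 + fst p * fst p + snd p * snd p) - 1)))
        with ((eps * eps) * (2 * / (1 + fst p * fst p + snd p * snd p) - 1) *
          (2 * / (1 + fst p * fst p + snd p * snd p) - 1)) by ring.
        rewrite He. field. lra.
      * rewrite slice_point_eq. unfold phi. f_equal. ring.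
    + rewrite H3. specialize (Hkpos p). nra.
    + unfold psi. rewrite H3. unfold q1, q2, phi; cbn [fst snd].
      specialize (Hkpos p). destruct p as [s t]; cbn [fst snd] in *.
      f_equal; field; lra.
  - intros y (J & HJ & ->) Hy. split; [easy|].
    apply imag_unit_iff in HJ. destruct HJ as (i1 & i2 & i3 & -> & Hi).
    rewrite slice_point_eq in *. unfold q3 in Hy; cbn [snd] in Hy.
    assert (Hd : 0 < 1 + eps * i3) by nra.
    assert (E : psi (alpha, beta * i1, beta * i2, beta * i3) =
                (i1 / (1 + eps * i3), i2 / (1 + eps * i3))).
    { unfold psi, q1, q2, q3; cbn [fst snd]. f_equal; field; nra. }
    rewrite E.
    (* On the unit sphere [i1^2 + i2^2 = (1 - eps i3)(1 + eps i3)], hence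
       [1 + s^2 + t^2 = 2 / (1 + eps i3)]. *)
    assert (Ek : k (i1 / (1 + eps * i3), i2 / (1 + eps * i3)) = (1 + eps * i3) / 2).
    { unfold k; cbn [fst snd].
      replace (1 + i1 / (1 + eps * i3) * (i1 / (1 + eps * i3)) +
        i2 / (1 + eps * i3) * (i2 / (1 + eps * i3)))
      with (2 / (1 + eps * i3)).
      - field. lra.
      - apply Rmult_eq_reg_r with ((1 + eps * i3) * (1 + eps * i3)); [|nra].
        field_simplify; [|lra|lra].
        replace (i1 ^ 2) with (1 - i2 * i2 - i3 * i3) by lra.
        replace (eps ^ 2) with 1 by lra. ring. }
    unfold phi. rewrite Ek; cbn [fst snd].
    f_equal; [f_equal; [f_equal|]|]; try (field; lra).
    replace (eps * beta * (2 * ((1 + eps * i3) / 2) - 1)) with ((eps * eps) * (beta * i3)) by field.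
    rewrite He. ring.
  - apply continuous_on_forall. intros y [_ Hy].
    assert (C3 : continuous q3 y) by (apply (proj1 (proj2 q3_coordinate)), continuous_id).
    assert (C : continuous (fun y : Quat => / (beta + eps * q3 y)) y).
    { apply continuous_Rinv'; [|lra].
      apply continuous_Rplus; [apply continuous_const|].
      apply continuous_Rmult; [apply continuous_const|exact C3]. }
    apply continuous_pair; apply continuous_Rmult; try exact C.
    + apply (proj1 (proj2 q1_coordinate)), continuous_id.
    + apply (proj1 (proj2 q2_coordinate)), continuous_id.
Qed.

(** * Recovering the base point from a quaternion *)

(** The second coordinate is normalised to be nonnegative, which makes the base point a continuous
    function of [x]. *)
Definition slice_coords (x : Quat) : R * R :=
  (q0 x, sqrt (q1 x * q1 x + q2 x * q2 x + q3 x * q3 x)).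

Lemma slice_coords_point (J : Quat) (alpha beta : R) :
  imag_unit J -> 0 < beta -> slice_coords (slice_point J alpha beta) = (alpha, beta).
Proof.
  intros HJ Hb. apply imag_unit_iff in HJ. destruct HJ as (j1 & j2 & j3 & -> & Hj).
  rewrite slice_point_eq. unfold slice_coords, q0, q1, q2, q3; cbn [fst snd]. f_equal.
  replace (beta * j1 * (beta * j1) + beta * j2 * (beta * j2) + beta * j3 * (beta * j3))
    with (beta * beta * (j1 * j1 + j2 * j2 + j3 * j3)) by ring.
  rewrite Hj, Rmult_1_r. apply sqrt_square. lra.
Qed.

Lemma slice_coords_continuous (x : Quat) : continuous slice_coords x.
Proof.
  assert (H0 : continuous q0 x) by (apply (proj1 (proj2 q0_coordinate)), continuous_id).
  assert (H1 : continuous q1 x) by (apply (proj1 (proj2 q1_coordinate)), continuous_id).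
  assert (H2 : continuous q2 x) by (apply (proj1 (proj2 q2_coordinate)), continuous_id).
  assert (H3 : continuous q3 x) by (apply (proj1 (proj2 q3_coordinate)), continuous_id).
  apply continuous_pair; [exact H0|].
  apply (continuous_comp (fun x => q1 x * q1 x + q2 x * q2 x + q3 x * q3 x) sqrt);
    [|apply continuous_sqrt].
  apply continuous_Rplus; [apply continuous_Rplus|]; now apply continuous_Rmult.
Qed.

(** [alpha + J beta = alpha + (- J)(- beta)], so the symmetry of [D] allows the sign of [beta] to be
    changed, and [beta = 0] would give a real point. *)
Lemma circular_set_pos (D : C -> Prop) (x : Quat) :
  conj_symmetric D -> (forall a : R, ~ circular_set D (qreal a)) -> circular_set D x ->
  exists alpha beta J, D (alpha, beta) /\ 0 < beta /\ imag_unit J /\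
    x = slice_point J alpha beta.
Proof.
  intros HD Hr (alpha & beta & J & HDz & HJ & ->).
  destruct (Rtotal_order beta 0) as [Hb|[->|Hb]].
  - exists alpha, (- beta), (qopp J).
    pose proof HJ as HJ'. apply imag_unit_iff in HJ'.
    destruct HJ' as (j1 & j2 & j3 & -> & Hj).
    change (qopp (0, j1, j2, j3)) with (- 0, - j1, - j2, - j3).
    rewrite Ropp_0. split; [exact (HD _ HDz)|]. split; [lra|]. split.
    + apply imag_unit_iff. exists (- j1), (- j2), (- j3). split; [easy|lra].
    + rewrite !slice_point_eq. apply quat_eq; ring.
  - exfalso. apply (Hr alpha). exists alpha, 0, J. split; [easy|split; [easy|]].
    apply imag_unit_iff in HJ. destruct HJ as (j1 & j2 & j3 & -> & Hj).
    rewrite slice_point_eq. apply quat_eq; ring.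
  - now exists alpha, beta, J.
Qed.

(** * Zeros of [A + J B] among the imaginary units *)

Definition qdot (A B : Quat) : R :=
  q0 A * q0 B + q1 A * q1 B + q2 A * q2 B + q3 A * q3 B.

(** The imaginary part of [- A B^{-1}], the only candidate for a unit [J] with [A + J B = 0]. *)
Definition unit_root (A B : Quat) : Quat :=
  (0,
   - (q1 A * q0 B - q0 A * q1 B - q2 A * q3 B + q3 A * q2 B) * / qdot B B,
   - (q2 A * q0 B - q0 A * q2 B + q1 A * q3 B - q3 A * q1 B) * / qdot B B,
   - (q3 A * q0 B - q0 A * q3 B - q1 A * q2 B + q2 A * q1 B) * / qdot B B).

(** The quaternion [- A B^{-1}] has real part [- <A, B> / |B|^2] and norm [|A| / |B|]; the
    hypotheses say that these are 0 and 1. *)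
Lemma unit_root_spec (A B : Quat) :
  qdot B B <> 0 -> qdot A A = qdot B B -> qdot A B = 0 ->
  imag_unit (unit_root A B) /\ qadd A (qmul (unit_root A B) B) = zero.
Proof.
  destruct A as [[[a0 a1] a2] a3], B as [[[b0 b1] b2] b3].
  unfold unit_root, qdot, q0, q1, q2, q3; cbn [fst snd].
  set (n := b0 * b0 + b1 * b1 + b2 * b2 + b3 * b3). intros Hn HA HAB. split.
  - apply imag_unit_iff. do 3 eexists. split; [reflexivity|].
    apply Rmult_eq_reg_r with (n * n); [|now apply Rmult_integral_contrapositive].
    (* The imaginary part of [A] times the conjugate of [B] has squared norm
       [|A|^2 |B|^2 - <A, B>^2]. *)
    transitivity ((a0 * a0 + a1 * a1 + a2 * a2 + a3 * a3) * n
      - (a0 * b0 + a1 * b1 + a2 * b2 + a3 * b3) * (a0 * b0 + a1 * b1 + a2 * b2 + a3 * b3)).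
    + field_simplify; [|exact Hn]. unfold n. ring.
    + rewrite HA, HAB. ring.
  - unfold qmul. rewrite qadd_eq.
    set (e := a0 * b0 + a1 * b1 + a2 * b2 + a3 * b3) in HAB.
    apply quat_eq; apply Rmult_eq_reg_r with n; try exact Hn.
    (* Dropping the real part of [- A B^{-1}] changes [A + J B] from 0 to [(e / n) B], and
       [e = 0]. *)
    + transitivity (e * b0); [field_simplify; [unfold e, n; ring|exact Hn]|rewrite HAB, Rmult_0_l; symmetry; exact (Rmult_0_l n)].
    + transitivity (e * b1); [field_simplify; [unfold e, n; ring|exact Hn]|rewrite HAB, Rmult_0_l; symmetry; exact (Rmult_0_l n)].
    + transitivity (e * b2); [field_simplify; [unfold e, n; ring|exact Hn]|rewrite HAB, Rmult_0_l; symmetry; exact (Rmult_0_l n)].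
    + transitivity (e * b3); [field_simplify; [unfold e, n; ring|exact Hn]|rewrite HAB, Rmult_0_l; symmetry; exact (Rmult_0_l n)].
Qed.

Lemma quat_eq_zero (a b c d : R) :
  (a, b, c, d) = (zero : Quat) -> a = 0 /\ b = 0 /\ c = 0 /\ d = 0.
Proof.
  intro H. assert (H' : (a, b, c, d) = (0, 0, 0, 0) :> Quat) by exact H.
  now injection H'.
Qed.

(** In [A = - J B] the factor [J] preserves norms, and being imaginary it sends [B] to a vector
    orthogonal to [B]. The conditions of [unit_root_spec] are thus necessary as well. *)
Lemma unit_root_unique (A B J : Quat) :
  qdot B B <> 0 -> imag_unit J -> qadd A (qmul J B) = zero ->
  qdot A A = qdot B B /\ qdot A B = 0 /\ J = unit_root A B.
Proof.
  intros Hn HJ H. apply imag_unit_iff in HJ. destruct HJ as (j1 & j2 & j3 & -> & Hj).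
  destruct A as [[[a0 a1] a2] a3], B as [[[b0 b1] b2] b3].
  unfold qmul in H. rewrite qadd_eq in H.
  unfold unit_root, qdot, q0, q1, q2, q3 in *; cbn [fst snd] in *.
  set (n := b0 * b0 + b1 * b1 + b2 * b2 + b3 * b3) in *.
  apply quat_eq_zero in H. destruct H as (H0 & H1 & H2 & H3).
  assert (E0 : a0 = j1 * b1 + j2 * b2 + j3 * b3) by lra.
  assert (E1 : a1 = - j1 * b0 - j2 * b3 + j3 * b2) by lra.
  assert (E2 : a2 = j1 * b3 - j2 * b0 - j3 * b1) by lra.
  assert (E3 : a3 = - j1 * b2 + j2 * b1 - j3 * b0) by lra.
  subst a0 a1 a2 a3. split; [|split].
  - transitivity ((j1 * j1 + j2 * j2 + j3 * j3) * n); [unfold n; ring|rewrite Hj; ring].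
  - ring.
  - apply quat_eq; [easy|..]; apply Rmult_eq_reg_r with n; try exact Hn;
      field_simplify; try exact Hn; unfold n; ring.
Qed.

(** The coordinate [q0] forces the first component of a kernel vector to vanish. The squared norm of
    the imaginary part is [snd p * snd p], with derivative [2 * snd p > 0] in the second variable,
    so [l2] cannot vanish. *)
Lemma slice_graph_immersion (W : R * R -> Prop) (phi : R * R -> Quat) :
  open W ->
  (forall p, W p -> q0 (phi p) = fst p) ->
  (forall p, W p -> q1 (phi p) * q1 (phi p) + q2 (phi p) * q2 (phi p)
                    + q3 (phi p) * q3 (phi p) = snd p * snd p) ->
  (forall p, W p -> 0 < snd p) ->
  immersive W phi.
Proof.
  intros HW H0 Hn Hpos p l1 l2 Hp P1 P2 x y Hxy.
  destruct q0_coordinate as (D0 & _), q1_coordinate as (D1 & _),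
    q2_coordinate as (D2 & _), q3_coordinate as (D3 & _).
  assert (E0 : x * q0 l1 + y * q0 l2 = 0) by exact (f_equal q0 Hxy).
  assert (E1 : x * q1 l1 + y * q1 l2 = 0) by exact (f_equal q1 Hxy).
  assert (E2 : x * q2 l1 + y * q2 l2 = 0) by exact (f_equal q2 Hxy).
  assert (E3 : x * q3 l1 + y * q3 l2 = 0) by exact (f_equal q3 Hxy).
  pose proof (open_section1 W p HW Hp) as S1. pose proof (open_section2 W p HW Hp) as S2.
  assert (A1 : q0 l1 = 1).
  { rewrite <- (is_derive_unique _ _ _ (D0 _ _ _ P1)). apply is_derive_unique.
    apply is_derive_ext_loc with (f := fun t => t).
    - revert S1; apply filter_imp; intros t Ht. now rewrite H0.
    - exact (is_derive_id (K := R_AbsRing) (fst p)). }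
  assert (A2 : q0 l2 = 0).
  { rewrite <- (is_derive_unique _ _ _ (D0 _ _ _ P2)). apply is_derive_unique.
    apply is_derive_ext_loc with (f := fun _ => fst p).
    - revert S2; apply filter_imp; intros t Ht. now rewrite H0.
    - apply R_is_derive_const. }
  assert (Hx : x = 0) by (rewrite A1, A2 in E0; lra).
  subst x. split; [easy|].
  apply NNPP. intro Hy.
  assert (Z : forall l, 0 * 0 + y * l = 0 -> l = 0).
  { intros l Hl. apply Rmult_eq_reg_l with y; lra. }
  assert (Z1 : q1 l2 = 0) by (apply Z; lra).
  assert (Z2 : q2 l2 = 0) by (apply Z; lra).
  assert (Z3 : q3 l2 = 0) by (apply Z; lra).
  pose proof (D1 _ _ _ P2) as Q1. pose proof (D2 _ _ _ P2) as Q2. pose proof (D3 _ _ _ P2) as Q3.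
  pose proof (is_derive_Rplus _ _ _ _ _ (is_derive_Rplus _ _ _ _ _
    (Derive.is_derive_mult _ _ _ _ _ Q1 Q1) (Derive.is_derive_mult _ _ _ _ _ Q2 Q2))
    (Derive.is_derive_mult _ _ _ _ _ Q3 Q3)) as Q.
  pose proof (is_derive_id (K := R_AbsRing) (snd p)) as I.
  pose proof (Derive.is_derive_mult (fun t => t) (fun t => t) (snd p) 1 1 I I) as I2.
  apply (is_derive_ext_loc _ (fun t => t * t)) in Q.
  - pose proof (eq_trans (eq_sym (is_derive_unique _ _ _ Q)) (is_derive_unique _ _ _ I2)) as E.
    rewrite Z1, Z2, Z3 in E. specialize (Hpos p Hp). lra.
  - revert S2; apply filter_imp; intros t Ht. exact (Hn (fst p, t) Ht).
Qed.

(** * Holomorphy of the stem function and of its norm *)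

Definition stem_component (F : C -> HC) (pr : Quat -> R) (z : C) : C :=
  (pr (fst (F z)), pr (snd (F z))).

(** Multiplication by sqrt(-1) in [HC] respects the four real coordinates, so [dbar F = 0] splits
    into Cauchy-Riemann equations for each of them. *)
Lemma stem_component_holomorphic (D : C -> Prop) (F : C -> HC) (pr : Quat -> R) :
  coordinate_like pr -> class_C 1 D F -> (forall z, D z -> is_dbar F z zero) ->
  exists g', holomorphic_on D (stem_component F pr) g'.
Proof.
  intros (Pd & Pc & Po & Pp & Ps) (F1 & F2 & HF & HF1 & HF2) Hdbar.
  exists (stem_component F1 pr). intros z Hz.
  destruct (HF z Hz) as [P1 P2].
  assert (Q : forall (G : C -> HC) (c : R -> C) x l, is_derive (fun t => G (c t)) x l ->
    C_is_derive (fun t => stem_component G pr (c t)) x ((pr (fst l), pr (snd l)) : C)).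
  { intros G c x l H. apply is_derive_pair; apply Pd.
    - exact (is_derive_fst _ _ _ H).
    - exact (is_derive_snd _ _ _ H). }
  split; [|split].
  - exact (Q F (fun t => (t, snd z)) _ _ P1).
  - eapply C_is_derive_eq; [exact (Q F (fun t => (fst z, t)) _ _ P2)|].
    destruct (Hdbar z Hz) as (Fa & Fb & Pa & Pb & H0).
    (* [is_dbar] brings its own partial derivatives; uniqueness identifies their coordinates with
       those of the continuous [F1] and [F2]. *)
    assert (U1 : (pr (fst (F1 z)), pr (snd (F1 z))) = (pr (fst Fa), pr (snd Fa)) :> C).
    { exact (C_is_derive_unique _ _ _ _ (Q F (fun t => (t, snd z)) _ _ P1)
        (Q F (fun t => (t, snd z)) _ _ Pa)). }
    assert (U2 : (pr (fst (F2 z)), pr (snd (F2 z))) = (pr (fst Fb), pr (snd Fb)) :> C).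
    { exact (C_is_derive_unique _ _ _ _ (Q F (fun t => (fst z, t)) _ _ P2)
        (Q F (fun t => (fst z, t)) _ _ Pb)). }
    rewrite U2. unfold stem_component. rewrite U1.
    assert (Z : pr zero = 0).
    { pose proof (Pp zero zero) as H. rewrite plus_zero_l in H. lra. }
    assert (R1 : 0 = 1 / 2 * (pr (fst Fa) + - pr (snd Fb))).
    { rewrite <- Z, <- Po, <- Pp, <- Ps. exact (f_equal (fun w => pr (fst w)) H0). }
    assert (R2 : 0 = 1 / 2 * (pr (snd Fa) + pr (fst Fb))).
    { rewrite <- Z, <- Pp, <- Ps. exact (f_equal (fun w => pr (snd w)) H0). }
    unfold Cmult, Ci; cbn [fst snd]. f_equal; lra.
  - apply continuous_pair; apply Pc.
    + exact (continuous_comp_fst _ _ (HF1 z Hz)).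
    + exact (continuous_comp_snd _ _ (HF1 z Hz)).
Qed.

(** The product of [F] with its quaternionic conjugate, which is the stem function of the normal
    function (symmetrization) of [f]. *)
Definition normal_stem (F : C -> HC) (z : C) : C :=
  (stem_component F q0 z * stem_component F q0 z
   + (stem_component F q1 z * stem_component F q1 z
   + (stem_component F q2 z * stem_component F q2 z
   + stem_component F q3 z * stem_component F q3 z)))%C.

(** With [F = F1 + sqrt(-1) F2] the real and imaginary parts are [|F1|^2 - |F2|^2] and [2 <F1, F2>]:
    vanishing is the solvability condition of [unit_root_spec]. *)
Lemma normal_stem_eq_0 (F : C -> HC) (z : C) :
  normal_stem F z = 0 <->
  qdot (fst (F z)) (fst (F z)) = qdot (snd (F z)) (snd (F z)) /\
  qdot (fst (F z)) (snd (F z)) = 0.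
Proof.
  unfold normal_stem, stem_component, qdot, Cplus, Cmult, RtoC; cbn [fst snd].
  split.
  - intro H. injection H as H1 H2. split; lra.
  - intros [H1 H2]. f_equal; lra.
Qed.

Lemma normal_stem_holomorphic (D : C -> Prop) (F : C -> HC) :
  open D -> class_C 1 D F -> (forall z, D z -> is_dbar F z zero) ->
  exists g', holomorphic_on D (normal_stem F) g'.
Proof.
  intros HD HF Hdbar.
  destruct (stem_component_holomorphic D F q0 q0_coordinate HF Hdbar) as [g0 G0].
  destruct (stem_component_holomorphic D F q1 q1_coordinate HF Hdbar) as [g1 G1].
  destruct (stem_component_holomorphic D F q2 q2_coordinate HF Hdbar) as [g2 G2].
  destruct (stem_component_holomorphic D F q3 q3_coordinate HF Hdbar) as [g3 G3].
  pose proof (holomorphic_mult D _ _ _ _ HD G0 G0) as S0.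
  pose proof (holomorphic_mult D _ _ _ _ HD G1 G1) as S1.
  pose proof (holomorphic_mult D _ _ _ _ HD G2 G2) as S2.
  pose proof (holomorphic_mult D _ _ _ _ HD G3 G3) as S3.
  eexists.
  exact (holomorphic_plus D _ _ _ _ S0
    (holomorphic_plus D _ _ _ _ S1 (holomorphic_plus D _ _ _ _ S2 S3))).
Qed.

Lemma stem_component_rational (D : C -> Prop) (F : C -> HC) (pr : Quat -> R) (z : C) (r : R)
    (W : R * R -> Prop) :
  open D -> coordinate_like pr -> class_C 1 D F -> (forall z, D z -> is_dbar F z zero) ->
  0 < r -> (forall u, Cmod (u - z) < 3 * r -> D u) ->
  (forall w : C, W w -> Cmod (w - z) < r / 2) ->
  rational_closure W (cauchy_components z r) (fun w => pr (fst (F w))) /\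
  rational_closure W (cauchy_components z r) (fun w => pr (snd (F w))).
Proof.
  intros HD Hpr HF Hdbar Hr Hball HW.
  destruct (stem_component_holomorphic D F pr Hpr HF Hdbar) as [g' Hg].
  destruct (holomorphic_cauchy_integral D _ g' z r HD Hg Hr Hball) as (h & Hh & E).
  split.
  - apply rc_ext with (g := fun w => Re (cauchy_integral z r h 0 w)).
    + apply rc_base. exists h, O. auto.
    + intros w Hw. now rewrite <- (E w (HW w Hw)).
  - apply rc_ext with (g := fun w => Im (cauchy_integral z r h 0 w)).
    + apply rc_base. exists h, O. auto.
    + intros w Hw. now rewrite <- (E w (HW w Hw)).
Qed.

Lemma open_Cmod_ball (z : C) (r : R) : open (fun w : C => Cmod (w - z) < r).
Proof.
  intros w Hw. apply locally_Cmod. exists (r - Cmod (w - z)). split; [lra|].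
  intros u Hu. replace (u - z)%C with ((u - w) + (w - z))%C by ring.
  pose proof (Cmod_triangle (u - w) (w - z)). lra.
Qed.

(** * The graph of zeros as a smooth surface *)

Definition root_point (F : C -> HC) (w : C) : Quat :=
  slice_point (unit_root (fst (F w)) (snd (F w))) (fst w) (snd w).

(** [unit_root] divides only by [qdot (snd (F w)) (snd (F w))], so the graph is rational in the
    components of [F], which are Cauchy integrals on the disc since [e <= r / 2]. *)
Lemma root_graph_smooth (D : C -> Prop) (F : C -> HC) (z : C) (r e : R) :
  open D -> class_C 1 D F -> (forall z, D z -> is_dbar F z zero) ->
  0 < r -> (forall u, Cmod (u - z) < 3 * r -> D u) -> e <= r / 2 ->
  (forall w, Cmod (w - z) < e ->
     0 < snd w /\ qdot (snd (F w)) (snd (F w)) <> 0 /\ normal_stem F w = 0) ->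
  smooth_surface (fun x => exists w, Cmod (w - z) < e /\ x = root_point F w).
Proof.
  intros HD HF Hdbar Hr Hball He HW x Hx.
  set (W := fun w : C => Cmod (w - z) < e) in *.
  assert (HWo : open W) by apply open_Cmod_ball.
  assert (Hroot : forall w, W w -> imag_unit (unit_root (fst (F w)) (snd (F w)))).
  { intros w Hw. destruct (HW w Hw) as (_ & Hn & H0).
    apply normal_stem_eq_0 in H0. now apply unit_root_spec. }
  assert (Hcoords : forall w, W w -> slice_coords (root_point F w) = w).
  { intros w Hw. unfold root_point. rewrite slice_coords_point; [now destruct w| |].
    - now apply Hroot.
    - now apply HW. }
  assert (Hrat : forall pr, coordinate_like pr ->
    rational_closure W (cauchy_components z r) (fun w => pr (fst (F w))) /\
    rational_closure W (cauchy_components z r) (fun w => pr (snd (F w)))).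
  { intros pr Hpr. apply (stem_component_rational D); try easy.
    intros w Hw. unfold W in Hw. lra. }
  destruct (Hrat q0 q0_coordinate), (Hrat q1 q1_coordinate), (Hrat q2 q2_coordinate),
    (Hrat q3 q3_coordinate).
  set (j := fun w => unit_root (fst (F w)) (snd (F w))).
  set (phi := fun w : R * R => (fst w, snd w * q1 (j w), snd w * q2 (j w), snd w * q3 (j w)) : Quat).
  assert (Hphi : forall w, root_point F w = phi w).
  { intro w. apply slice_point_eq. }
  (* [slice_coords] is continuous everywhere and inverts the graph, so a single chart covers the
     surface. *)
  exists (fun _ => True), W, phi, slice_coords.
  split; [apply open_true|]. split; [easy|]. split; [exact HWo|].
  split; [|split; [|split; [|split]]].
  - apply (rational_closure_quat_smooth W (cauchy_components z r) (fun w => fst w)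
      (fun w => snd w * q1 (j w)) (fun w => snd w * q2 (j w)) (fun w => snd w * q3 (j w))).
    + exact HWo.
    + apply cauchy_components_partials; [exact Hr|]. intros w Hw. unfold W in Hw. lra.
    + rational.
    + unfold j, unit_root, qdot, q1; cbn [fst snd]. rational. intros; now apply HW.
    + unfold j, unit_root, qdot, q2; cbn [fst snd]. rational. intros; now apply HW.
    + unfold j, unit_root, qdot, q3; cbn [fst snd]. rational. intros; now apply HW.
  - apply slice_graph_immersion; [exact HWo|reflexivity| |].
    + intros w Hw. pose proof (Hroot w Hw) as HJ. fold (j w) in HJ.
      apply imag_unit_iff in HJ. destruct HJ as (j1 & j2 & j3 & E & Hj).
      unfold phi. rewrite E. unfold q1, q2, q3; cbn [fst snd].
      transitivity (snd w * snd w * (j1 * j1 + j2 * j2 + j3 * j3)); [ring|].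
      rewrite Hj; ring.
    + intros w Hw. now apply HW.
  - intros w Hw. split; [|split; [easy|]].
    + exists w. split; [exact Hw|]. now rewrite Hphi.
    + rewrite <- Hphi. now apply Hcoords.
  - intros y (w & Hw & ->) _. rewrite Hcoords by easy. now rewrite Hphi.
  - apply continuous_on_forall. intros; apply slice_coords_continuous.
Qed.

Lemma qdot_self_neq_0 (B : Quat) : B <> zero -> qdot B B <> 0.
Proof.
  intros HB H. apply HB. destruct B as [[[b0 b1] b2] b3].
  unfold qdot, q0, q1, q2, q3 in H; cbn [fst snd] in H.
  apply (quat_eq _ _ _ _ 0 0 0 0); nra.
Qed.

Theorem theorem18 :
  forall (D : C -> Prop) (f : Quat -> Quat) (x0 : Quat),
    open D ->
    conj_symmetric D ->
    connected (circular_set D) ->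
    (forall a : R, ~ circular_set D (qreal a)) ->
    slice_regular D f ->
    ~ constant_on (circular_set D) f ->
    zero_set D f x0 ->
    ~ isolated (zero_set D f) x0 ->
    exists M : Quat -> Prop,
      smooth_surface M /\
      (forall x, M x -> circular_set D x) /\
      M x0 /\
      (forall x, M x -> zero_set D f x).
Proof.
  intros D f x0 HD Hsym _ Hreal (F & _ & Hind & HF & Hdbar) _ Hx0 Hiso.
  destruct (circular_set_pos D x0 Hsym Hreal (proj1 Hx0)) as (a & b & J0 & Hz & Hb & HJ0 & Ex0).
  set (z := (a, b) : C) in *.
  assert (H0 : qadd (fst (F z)) (qmul J0 (snd (F z))) = zero).
  { unfold z. rewrite <- (Hind a b J0 Hz HJ0), <- Ex0. exact (proj2 Hx0). }
  (* By [H0], if the second component vanishes then so does the first: this is the case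
     [F z = 0]. *)
  destruct (classic (snd (F z) = zero)) as [HB|HB].
  - exists (fun x => exists J, imag_unit J /\ x = slice_point J a b).
    assert (Hmul : forall J, qmul J zero = zero).
    { intros [[[c0 c1] c2] c3]. change (zero : Quat) with ((0, 0, 0, 0) : Quat).
      unfold qmul. apply quat_eq; ring. }
    assert (HA : fst (F z) = zero).
    { rewrite HB, Hmul in H0. unfold qadd in H0. now rewrite plus_zero_r in H0. }
    assert (Hcirc : forall x, (exists J, imag_unit J /\ x = slice_point J a b) -> circular_set D x).
    { intros x (J & HJ & ->). now exists a, b, J. }
    split; [now apply slice_sphere_smooth|]. split; [exact Hcirc|]. split; [now exists J0|].
    intros x Hx. split; [now apply Hcirc|]. destruct Hx as (J & HJ & ->).
    rewrite (Hind a b J Hz HJ). fold z. rewrite HA, HB, Hmul.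
    unfold qadd. apply plus_zero_r.
  - apply qdot_self_neq_0 in HB.
    destruct (unit_root_unique _ _ _ HB HJ0 H0) as (E1 & E2 & EJ0).
    destruct (normal_stem_holomorphic D F HD HF Hdbar) as [N' HN].
    destruct (open_ball_Cmod D z HD Hz) as (rho & Hrho & Hball).
    assert (Hloc : locally z (fun w : C => 0 < snd w /\ qdot (snd (F w)) (snd (F w)) <> 0)).
    { assert (HC : forall pr, coordinate_like pr -> continuous (fun w : C => pr (snd (F w))) z).
      { intros pr Hpr.
        destruct (stem_component_holomorphic D F pr Hpr HF Hdbar) as [g' Hg].
        exact (continuous_Im _ z (holomorphic_continuous D _ g' z HD Hg Hz)). }
      pose proof (HC q0 q0_coordinate). pose proof (HC q1 q1_coordinate).
      pose proof (HC q2 q2_coordinate). pose proof (HC q3 q3_coordinate).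
      assert (Hq : continuous (fun w : C => qdot (snd (F w)) (snd (F w))) z).
      { repeat apply continuous_Rplus; now apply continuous_Rmult. }
      apply filter_and.
      - exact (continuous_snd a b _ (open_gt 0 b Hb)).
      - exact (Hq _ (open_neq 0 _ HB)). }
    apply locally_Cmod in Hloc. destruct Hloc as (d & Hd & Hdn).
    destruct (holomorphic_zero_dichotomy D _ N' z HD HN Hz) as [(e & He & HNe)|(e & He & HNe)].
    + set (r := rho / 3).
      (* [r / 2] is the range of Cauchy's formula, [d] that where [snd w > 0] and [snd (F w)] is
         nonzero, and [e] that where [N] vanishes. *)
      set (s := Rmin (r / 2) (Rmin d e)).
      assert (Hr : 0 < r) by (unfold r; lra).
      assert (Hs : 0 < s) by (unfold s; repeat apply Rmin_pos; lra).
      assert (Hs1 : s <= r / 2) by apply Rmin_l.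
      assert (Hs2 : s <= d) by (eapply Rle_trans; [apply Rmin_r|apply Rmin_l]).
      assert (Hs3 : s <= e) by (eapply Rle_trans; [apply Rmin_r|apply Rmin_r]).
      assert (Hball' : forall u, Cmod (u - z) < 3 * r -> D u).
      { intros u Hu. apply Hball. unfold r in Hu. lra. }
      assert (HW : forall w, Cmod (w - z) < s ->
        0 < snd w /\ qdot (snd (F w)) (snd (F w)) <> 0 /\ normal_stem F w = 0).
      { intros w Hw. destruct (Hdn w) as [Hw1 Hw2]; [lra|].
        split; [exact Hw1|split; [exact Hw2|]]. apply HNe. lra. }
      exists (fun x => exists w, Cmod (w - z) < s /\ x = root_point F w).
      assert (Hroot : forall w, Cmod (w - z) < s ->
        D w /\ imag_unit (unit_root (fst (F w)) (snd (F w))) /\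
        qadd (fst (F w)) (qmul (unit_root (fst (F w)) (snd (F w))) (snd (F w))) = zero).
      { intros w Hw. split; [apply Hball'; lra|].
        destruct (HW w Hw) as (_ & Hn & HN0). apply normal_stem_eq_0 in HN0.
        now apply unit_root_spec. }
      assert (Hcirc : forall x, (exists w, Cmod (w - z) < s /\ x = root_point F w) ->
        circular_set D x).
      { intros x ([u v] & Hw & ->). destruct (Hroot _ Hw) as (H1 & H2 & _).
        now exists u, v, (unit_root (fst (F (u, v))) (snd (F (u, v)))). }
      split; [|split; [exact Hcirc|split]].
      * now apply (root_graph_smooth D F z r s).
      * exists z. split; [|unfold root_point; now rewrite <- EJ0].
        replace (z - z)%C with (RtoC 0) by ring. now rewrite Cmod_0.
      * intros x Hx. split; [now apply Hcirc|].
        destruct Hx as ([u v] & Hw & ->). destruct (Hroot _ Hw) as (H1 & H2 & H3).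
        unfold root_point. cbn [fst snd]. now rewrite (Hind u v _ H1 H2).
    (* A zero of [f] close to [x0] lies over a zero of [N] close to [z], hence over [z] itself; on
       that sphere [x0] is the only zero, so [x0] would be isolated. *)
    + exfalso. apply Hiso. split; [exact Hx0|].
      assert (Hl : locally (slice_coords x0) (fun w : C => Cmod (w - z) < Rmin d e)).
      { rewrite Ex0, (slice_coords_point J0 a b HJ0 Hb). apply locally_Cmod.
        exists (Rmin d e). split; [now apply Rmin_pos|auto]. }
      pose proof (slice_coords_continuous x0 _ Hl) as Hl'. unfold filtermap in Hl'.
      revert Hl'. apply filter_imp. intros y Hy [Hyc Hy0].
      destruct (circular_set_pos D y Hsym Hreal Hyc) as (u & v & J & Huv & Hv & HJ & ->).
      rewrite (slice_coords_point J u v HJ Hv) in Hy.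
      rewrite (Hind u v J Huv HJ) in Hy0.
      pose proof (Rmin_l d e). pose proof (Rmin_r d e).
      destruct (Hdn (u, v)) as [_ Hn]; [lra|].
      destruct (unit_root_unique _ _ _ Hn HJ Hy0) as (G1 & G2 & GJ).
      assert (Euv : (u, v) = z).
      { apply NNPP. intro Hne. apply (HNe (u, v) Hne); [lra|].
        now apply normal_stem_eq_0. }
      rewrite Euv, <- EJ0 in GJ. unfold z in Euv. injection Euv as -> ->.
      now rewrite GJ, Ex0.
Qed.
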